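(* Assume that $i_n$, $n\ge0$, are i.i.d. random variables uniformly distributed on $\{1,\dots,d\}$ (independent of $(g_n)$ and $Z_0$). Then for every $n\ge1$ the quadratic Wasserstein distance between the law of $X_n$ and $N(0,V)$ is at most $d/\sqrt n$; for every $n\ge0$, $$\sum_{j=0}^n E(\|M_j\|^2)\le d^2;$$ the sequence $\big(E(\|M_j\|^2)\big)_{j\ge0}$ is non-increasing; and for every $n\ge1$, $X_n$ is centered, $\mathrm{cov}(X_n)\le V$, and $$\operatorname{tr}\big(V-\mathrm{cov}(X_n)\big)\le \frac{d^2}{n}.$$
   Context: Let $d\ge1$ and let $V$ be a real symmetric positive semi-definite $d\times d$ matrix whose diagonal entries all equal $1$. Write $\sqrt V$ for its symmetric positive semi-definite square root and $I$ for the $d\times d$ identity matrix. Let $e_i$ be the $i$-th standard basis column vector of $\mathbb R^d$. Let $(i_n)_{n\ge0}$ be a sequence of indices in $\{1,\dots,d\}$. Let $(g_n)_{n\ge0}$ be i.i.d. standard Gaussian random variables, and let $Z_0$ be a $d$-dimensional vector of i.i.d. standard Gaussian random variables, with $(i_n)$, $(g_n)$ and $Z_0$ mutually independent. Define $X_0=0$ and $X_{n+1}=X_n+(g_n-e_{i_n}^TX_n)\,Ve_{i_n}$ for $n\ge0$. For $1\le i\le d$ let $f_i=\sqrt V e_i$ and $P_i=I-f_if_i^T$. For $0\le m\le n$ let $M_{m,n}=P_{i_{n-1}}P_{i_{n-2}}\cdots P_{i_m}$ with $M_{n,n}=I$, and $M_n=M_{0,n}$. For a $d\times d$ matrix $A$,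 $\|A\|=\sqrt{\operatorname{tr}(A^TVA)}$; for a vector $x$, $\|x\|$ is its Euclidean norm. For a centered random vector $Z$ with finite second moments, $\mathrm{cov}(Z)=E(ZZ^T)$. For symmetric matrices, $A\le B$ means $B-A$ is positive semi-definite. The quadratic Wasserstein distance between probability measures $\mu,\mu'$ on $\mathbb R^d$ is $\mathcal W_2(\mu,\mu')=\big(\inf E\|Y-Y'\|^2\big)^{1/2}$, the infimum over all couplings with $Y\sim\mu$, $Y'\sim\mu'$. *)

(* Defs.v *)
From mathcomp Require Import all_boot all_order all_algebra.
From mathcomp Require Import all_classical all_reals all_analysis.

Set Implicit Arguments.
Unset Strict Implicit.
Unset Printing Implicit Defensive.

Import Order.TTheory GRing.Theory Num.Theory.
Local Open Scope classical_set_scope.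
Local Open Scope ring_scope.

Section Defs.
Variable R : realType.

Definition ecol (d : nat) (k : 'I_d) : 'cV[R]_d := delta_mx k 0.

Definition symmetric_mx (d : nat) (A : 'M[R]_d) : Prop := A^T = A.
Definition psd_mx (d : nat) (A : 'M[R]_d) : Prop :=
  symmetric_mx A /\ forall x : 'cV[R]_d, 0 <= (x^T *m A *m x) 0 0.
Definition loewner_le (d : nat) (A B : 'M[R]_d) : Prop := psd_mx (B - A).

Definition mnorm (d : nat) (V A : 'M[R]_d) : R := Num.sqrt (\tr (A^T *m V *m A)).

Definition vnorm (d : nat) (x : 'cV[R]_d) : R := Num.sqrt (\sum_k (x k 0) ^+ 2).

Fixpoint Xproc (d : nat) (V : 'M[R]_d) (T : Type) (i : nat -> T -> 'I_d)
    (g : nat -> T -> R) (n : nat) (w : T) : 'cV[R]_d :=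
  match n with
  | 0 => 0
  | n'.+1 =>
      let x := Xproc V i g n' w in
      x + (g n' w - ((ecol (i n' w))^T *m x) 0 0) *: (V *m ecol (i n' w))
  end.

(* f_k = sqrt V e_k,  P_k = I - f_k f_k^T  (S plays the role of sqrt V) *)
Definition fvec (d : nat) (S : 'M[R]_d) (k : 'I_d) : 'cV[R]_d := S *m ecol k.
Definition Pproj (d : nat) (S : 'M[R]_d) (k : 'I_d) : 'M[R]_d :=
  1%:M - fvec S k *m (fvec S k)^T.

Fixpoint Mprod (d : nat) (S : 'M[R]_d) (T : Type) (i : nat -> T -> 'I_d)
    (n : nat) (w : T) : 'M[R]_d :=
  match n with
  | 0 => 1%:M
  | n'.+1 => Pproj S (i n' w) *m Mprod S i n' w
  end.

Definition mutually_independent (d0 : measure_display) (T : measurableType d0)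
    (P : probability T R) (I : eqType) (E : I -> set (set T)) : Prop :=
  forall (J : seq I) (F : I -> set T), uniq J ->
    (forall j, j \in J -> E j (F j)) ->
    P (\big[setI/setT]_(j <- J) F j) = (\prod_(j <- J) P (F j))%E.

(* R^d is represented, as a measurable space, by d.-tuple R (product sigma-algebra
   = Borel sigma-algebra of R^d) *)
Definition tup (d : nat) (x : 'cV[R]_d) : d.-tuple R := mktuple (fun k => x k 0).

Definition is_coupling (d0 : measure_display) (T : measurableType d0)
    (P : probability T R) (d : nat) (X Y : T -> 'cV[R]_d)
    (mu : probability (d.-tuple R * d.-tuple R)%type R) : Prop :=
  forall A : set (d.-tuple R), measurable A ->
    mu (fst @^-1` A) = P ((fun w => tup (X w)) @^-1` A) /\
    mu (snd @^-1` A) = P ((fun w => tup (Y w)) @^-1` A).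

Definition sqdist (d : nat) (z : d.-tuple R * d.-tuple R) : R :=
  \sum_(k < d) (tnth z.1 k - tnth z.2 k) ^+ 2.

Definition W2sq (d0 : measure_display) (T : measurableType d0)
    (P : probability T R) (d : nat) (X Y : T -> 'cV[R]_d) : \bar R :=
  ereal_inf [set (\int[mu]_z (sqdist z)%:E)%E
            | mu in [set mu | is_coupling P X Y mu]].

Definition W2 (d0 : measure_display) (T : measurableType d0)
    (P : probability T R) (d : nat) (X Y : T -> 'cV[R]_d) : \bar R :=
  match W2sq P X Y with
  | EFin r => (Num.sqrt r)%:E
  | e => e
  end.

Definition Ex (d0 : measure_display) (T : measurableType d0)
    (P : probability T R) (f : T -> R) : \bar R := (\int[P]_w (f w)%:E)%E.

(* covariance matrix cov(Z) = E(Z Z^T) of a centered random vector *)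
Definition covmx (d0 : measure_display) (T : measurableType d0)
    (P : probability T R) (d : nat) (Z : T -> 'cV[R]_d) : 'M[R]_d :=
  \matrix_(k, l) fine (Ex P (fun w => Z w k 0 * Z w l 0)).

End Defs.

(* Main.v *)
(** Write [S] for the square root of [V], so that [X n = S U n] with
    [U (n+1) = P U n + g_n f], where [f = f_{i_n}] is a unit vector and
    [P = I - f f^T].  Started from [Z0] instead of [0], the same recursion
    gives [U' n = U n + M_n Z0].  Given the indices, [U' n] is standard
    Gaussian: the reflection of the Gaussian vector [(U' n, g_n)] along
    [(f, -1)] has [U' (n+1)] as its first block.  Hence [S U' n] has law
    [N(0, V)] and the coupling [(X n, S U' n)] has cost [E |M_n|^2]; the same
    number is the trace of [V - cov (X n)].
    Averaging over the last index shows that [E |M_n|^2] is the trace of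
    [L^n V], where [L A] is the mean of the [P_k A P_k].  The map [L] decreases
    the trace of positive semi-definite matrices, and [L I = I - V / d], so the
    sum of the traces of the [L^j V] telescopes and is at most [d * tr I]. *)

Require Import Defs.
From mathcomp Require Import all_boot all_order all_algebra.
From mathcomp Require Import all_classical all_reals all_analysis.
From mathcomp Require Import measurable_realfun ring lra.

Set Implicit Arguments.
Unset Strict Implicit.
Unset Printing Implicit Defensive.

Import Order.TTheory GRing.Theory Num.Theory.
Import numFieldNormedType.Exports.
Local Open Scope classical_set_scope.
Local Open Scope ring_scope.

(** * The Gaussian law on the line and on the plane *)

Definition mfun_of d d' (T : measurableType d) (T' : measurableType d')
    (f : T -> T') (mf : measurable_fun setT f) : {mfun T >-> T'} :=
  mfun_Sub (mem_set mf).

Section Gauss.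
Variable R : realType.
Notation mu := (@lebesgue_measure R).
Notation gauss := (@normal_prob R 0 1).

(** The image of Lebesgue measure under a translation gives every interval its length, so by
    uniqueness it is Lebesgue measure again. *)
Lemma ge0_integral_shift (f : R -> \bar R) (a : R) :
  measurable_fun [set: R] f -> (forall x, 0 <= f x)%E ->
  (\int[mu]_x f (x + a)%R = \int[mu]_x f x)%E.
Proof.
move=> mf f0.
have mD : measurable_fun setT ((fun x => x + a) : R -> measurableTypeR R).
  exact: measurable_funD.
transitivity (\int[pushforward mu (mfun_of mD)]_x f x)%E.
  by rewrite ge0_integral_pushforward.
apply: eq_measure_integral => /= A mA _.
apply/esym; apply: lebesgue_measure_unique => //= _ [[b c]] _ <-.
rewrite /pushforward (_ : _ @^-1` _ = `]b - a, c - a]%classic).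
  rewrite !lebesgue_measure_itv/= !lte_fin ltrD2r; case: ifP => // _.
  by congr EFin; ring.
by apply/seteqP; split => x /=; rewrite !in_itv/= ltrBlDr lerBrDr.
Qed.

(** The Radon-Nikodym derivative of the normal law and the explicit density have the same integral
    over every measurable set, hence agree almost everywhere. *)
Lemma ge0_integral_normal_prob (m s : R) (f : R -> \bar R) :
  measurable_fun [set: R] f -> (forall x, 0 <= f x)%E ->
  (\int[normal_prob m s]_x f x = \int[mu]_x (f x * (normal_pdf m s x)%:E))%E.
Proof.
move=> mf f0.
have dom := @normal_prob_dominates R m s.
rewrite -(Radon_Nikodym_SigmaFinite.change_of_variables dom)//.
have mpdf : measurable_fun setT (EFin \o normal_pdf m s).
  by apply/measurable_EFinP; exact: measurable_normal_pdf.
have RNi := Radon_Nikodym_SigmaFinite.f_integrable dom.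
apply: ae_eq_integral => //.
- by apply: emeasurable_funM => //; exact: measurable_int RNi.
- exact: emeasurable_funM.
- apply: ae_eqe_mul2l => /=.
  apply: integral_ae_eq => //= E _ mE.
  by rewrite -(Radon_Nikodym_SigmaFinite.f_integral dom).
Qed.

Let ge0_integral_linear (k : R) (f g : R -> \bar R) : 0 <= k ->
  measurable_fun [set: R] f -> measurable_fun [set: R] g ->
  (forall x, 0 <= f x)%E -> (forall x, 0 <= g x)%E ->
  (\int[mu]_x (f x + k%:E * g x) = \int[mu]_x f x + k%:E * \int[mu]_x g x)%E.
Proof.
move=> k0 mf mg f0 g0; rewrite ge0_integralD//.
- by rewrite ge0_integralZl_EFin.
- by move=> x _; rewrite mule_ge0.
- exact: measurable_funeM.
Qed.

Lemma integral_sqr_gauss : (\int[gauss]_x (x ^+ 2)%:E = 1)%E.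
Proof.
have eqW (x y : R) : x = y -> x <= y by move->.
have mpdf s : measurable_fun setT (EFin \o (@normal_pdf R 0 s)).
  by apply/measurable_EFinP; exact: measurable_normal_pdf.
have pdf0 s x : (0 <= (@normal_pdf R 0 s x)%:E)%E.
  by rewrite lee_fin normal_pdf_ge0.
have msqr : measurable_fun setT (fun x : R => (x ^+ 2)%:E).
  by apply/measurable_EFinP; exact: measurable_funX.
have mxpdf : measurable_fun setT (fun x : R => (x ^+ 2)%:E * (normal_pdf 0 1 x)%:E)%E.
  exact: (emeasurable_funM msqr (mpdf 1)).
have xpdf0 (x : R) : (0 <= (x ^+ 2)%:E * (normal_pdf 0 1 x)%:E)%E.
  by rewrite mule_ge0// lee_fin sqr_ge0.
rewrite ge0_integral_normal_prob//; last by move=> x; rewrite lee_fin sqr_ge0.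
set m := (\int[mu]_x _)%E.
have m0 : (0 <= m)%E by exact: integral_ge0.
(* The tangent line of [exp] at [- x^2 / 2] compares the densities of the
   variances [1] and [s^2]; integrating and letting [s] tend to [1] from both
   sides pins down the second moment. *)
have tangent (s x : R) : 0 < s ->
    normal_pdf 0 1 x * (1 + x ^+ 2 / 2 * (1 - s ^- 2)) <= s * normal_pdf 0 s x.
  move=> s0.
  have pdfE t : t != 0 -> normal_pdf 0 t x = normal_peak t * normal_fun 0 t x.
    by move=> t0; rewrite normal_pdfE.
  rewrite !pdfE ?gt_eqF//.
  rewrite (_ : normal_peak s = normal_peak 1 / s); last first.
    rewrite /normal_peak expr1n mul1r -mulrnAr sqrtrM ?sqr_ge0//.
    by rewrite sqrtr_sqr gtr0_norm// invfM mulrC.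
  rewrite [leRHS](_ : _ = normal_peak 1 * normal_fun 0 s x); last first.
    by field; rewrite gt_eqF.
  rewrite -(mulrA (normal_peak 1)); apply: ler_wpM2l; first exact: normal_peak_ge0.
  rewrite /normal_fun !subr0.
  rewrite (_ : - x ^+ 2 / (s ^+ 2 *+ 2) =
    - x ^+ 2 / (1 ^+ 2 *+ 2) + x ^+ 2 / 2 * (1 - s ^- 2)); last first.
    by field; rewrite gt_eqF.
  by rewrite expRD; apply: ler_wpM2l; rewrite ?expR_ge0// expR_ge1Dx.
have mkxpdf k : measurable_fun [set: R]
    (fun x : R => k%:E * ((x ^+ 2)%:E * (normal_pdf 0 1 x)%:E))%E.
  exact: (measurable_funeM k%:E mxpdf).
have mkpdf k s : measurable_fun [set: R] (fun x : R => k%:E * (normal_pdf 0 s x)%:E)%E.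
  exact: (measurable_funeM k%:E (mpdf s)).
have pdf1 s := @integral_normal_pdf R 0 s.
have ints s : 0 < s ->
    (\int[mu]_x (s%:E * (normal_pdf 0 s x)%:E) = s%:E)%E.
  move=> s0; rewrite ge0_integralZl_EFin ?pdf1 ?mule1//.
    exact: mpdf.
  exact: ltW.
have upper s : 1 < s -> (((1 - s ^- 2) / 2)%:E * m <= (s - 1)%:E)%E.
  move=> s1; have s0 : 0 < s by exact: lt_trans s1.
  have k0 : 0 <= (1 - s ^- 2) / 2.
    by rewrite divr_ge0// subr_ge0 invf_le1 ?exprn_gt0// exprn_ege1// ltW.
  rewrite EFinB leeBrDl//.
  have := ge0_integral_linear k0 (mpdf 1) mxpdf (pdf0 1) xpdf0.
  rewrite /= pdf1 => <-; rewrite -[leRHS](ints _ s0).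
  apply: ge0_le_integral => //.
  - by move=> x _; rewrite adde_ge0// mule_ge0.
  - exact: (emeasurable_funD (mpdf 1) (mkxpdf _)).
  - exact: (mkpdf s s).
  - move=> x _; rewrite -!EFinM -EFinD lee_fin.
    by apply: le_trans (tangent s x s0); apply: eqW; ring.
(* For [s < 1] the coefficient [1 - s ^- 2] is negative; its term moves to the other side so that
   only non-negative functions are integrated. *)
have lower s : 0 < s -> s < 1 -> (1 <= s%:E + ((s ^- 2 - 1) / 2)%:E * m)%E.
  move=> s0 s1.
  have k0 : 0 <= (s ^- 2 - 1) / 2.
    by rewrite divr_ge0// subr_ge0 invf_ge1 ?exprn_gt0// exprn_ile1// ltW.
  have spdf0 x : (0 <= s%:E * (normal_pdf 0 s x)%:E)%E.
    by rewrite mule_ge0// lee_fin ltW.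
  have := ge0_integral_linear k0 (mkpdf s s) mxpdf spdf0 xpdf0.
  rewrite /= ints// => <-; rewrite -[leLHS](pdf1 1).
  apply: ge0_le_integral => //.
  - exact: (mpdf 1).
  - exact: (emeasurable_funD (mkpdf s s) (mkxpdf _)).
  - move=> x _; rewrite -!EFinM -EFinD lee_fin -lerBlDr.
    by apply: le_trans (tangent s x s0); apply: eqW; ring.
(* At [s = 2] the upper bound reads [3/8 * m <= 1], which excludes an infinite [m]. *)
have : m \is a fin_num.
  rewrite ge0_fin_numE// ltey; apply/eqP => moo.
  have := upper 2 (ltr1n _ 2).
  rewrite moo gt0_muley ?lte_fin; last by lra.
  by rewrite leye_eq.
move: m upper lower m0 {mxpdf xpdf0} => [r||]// upper lower m0 _.
rewrite lee_fin in m0.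
congr EFin; apply/eqP; rewrite eq_le; apply/andP; split; rewrite leNgt; apply/negP => r1.
(* With [s ^+ 2] the midpoint of [1] and [r], the bound [(s + 1) * r <= 2 * s ^+ 2 = 1 + r] becomes
   [s * r <= 1], although [s] and [r] both exceed [1]. The other case is symmetric. *)
- pose s := Num.sqrt ((1 + r) / 2).
  have s2 : s ^+ 2 = (1 + r) / 2 by rewrite sqr_sqrtr//; lra.
  have s0 : 0 <= s by exact: sqrtr_ge0.
  have s1 : 1 < s by rewrite -(@ltr_pXn2r _ 2)// ?nnegrE// s2; lra.
  have := upper _ s1; rewrite -EFinM lee_fin => h.
  have {}h : (s + 1) * r <= 2 * s ^+ 2.
    rewrite -(ler_pM2l (_ : 0 < s - 1)) ?subr_gt0//.
    rewrite -(ler_pM2l (_ : 0 < s ^- 2 / 2)); last first.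
      by rewrite divr_gt0// invr_gt0 exprn_gt0//; lra.
    by apply: le_trans (le_trans _ h) _; apply: eqW; field; rewrite gt_eqF//; lra.
  nra.
- pose s := Num.sqrt ((1 + r) / 2).
  have s2 : s ^+ 2 = (1 + r) / 2 by rewrite sqr_sqrtr//; lra.
  have s0 : 0 < s by rewrite sqrtr_gt0; lra.
  have s1 : s < 1 by rewrite -(@ltr_pXn2r _ 2)// ?nnegrE// ?s2 ?ltW//; lra.
  have := lower _ s0 s1; rewrite -EFinM -EFinD lee_fin => h.
  have {}h : 2 * s ^+ 2 <= (s + 1) * r.
    rewrite -(ler_pM2l (_ : 0 < 1 - s)) ?subr_gt0//.
    rewrite -(ler_pM2l (_ : 0 < s ^- 2 / 2)); last first.
      by rewrite divr_gt0// invr_gt0 exprn_gt0//; lra.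
    rewrite -lerBlDl in h.
    by apply: le_trans (le_trans _ h) _; apply: eqW; field; rewrite gt_eqF//; lra.
  nra.
Qed.

(** Lebesgue measure and the centered density are both invariant under [x -> - x]. *)
Lemma gaussN (A : set R) : measurable A -> gauss (-%R @^-1` A) = gauss A.
Proof.
move=> mA; rewrite /normal_prob.
have mN : measurable_fun setT (-%R : R -> measurableTypeR R).
  exact: measurable_funN.
transitivity (\int[pushforward mu (-%R : R -> measurableTypeR R)]_(x in A)
   (normal_pdf 0 1 x)%:E)%E; last first.
  by apply: eq_measure_integral => B mB _; exact: lebesgue_measureN.
rewrite ge0_integral_pushforward//; last 2 first.
- by apply/measurable_funTS/measurable_EFinP; exact: measurable_normal_pdf.
- by move=> x _; rewrite lee_fin normal_pdf_ge0.
apply: eq_integral => x _ /=; congr EFin.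
by rewrite !normal_pdfE ?oner_eq0// /normal_fun !subr0 sqrrN.
Qed.

End Gauss.

(** * Rotation invariance of the Gaussian measure on the plane *)

Section Gauss2.
Variable R : realType.
Notation T1 := (measurableTypeR R).
Notation mu := (@lebesgue_measure R).
Notation gauss := (@normal_prob R 0 1).

(** As an iterated integral, it makes a vertical shear a translation of the inner variable, and a
    horizontal one likewise once Tonelli has swapped the order. *)
Let iint (F : T1 * T1 -> \bar R) : \bar R := (\int[mu]_x \int[mu]_y F (x, y))%E.

Definition shearx (t : R) (z : T1 * T1) : T1 * T1 := ((z.1 + t * z.2)%R, z.2).
Definition sheary (t : R) (z : T1 * T1) : T1 * T1 := (z.1, (z.2 + t * z.1)%R).
Definition rot (c s : R) (z : T1 * T1) : T1 * T1 :=
  ((c * z.1 + s * z.2)%R, (- s * z.1 + c * z.2)%R).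

Let measurable_lin (a b : R) :
  measurable_fun [set: T1 * T1] (fun z => (a * z.1 + b * z.2)%R : T1).
Proof.
apply: measurable_funD; apply: measurable_funM => //.
Qed.

Lemma measurable_rot c s : measurable_fun [set: T1 * T1] (rot c s).
Proof. by apply: measurable_fun_pair; exact: measurable_lin. Qed.

Let measurable_shearx t : measurable_fun [set: T1 * T1] (shearx t).
Proof.
apply: measurable_fun_pair => //.
under eq_fun do rewrite -[X in X + _]mul1r.
exact: measurable_lin.
Qed.

Let measurable_sheary t : measurable_fun [set: T1 * T1] (sheary t).
Proof.
apply: measurable_fun_pair => //.
under eq_fun do rewrite -[X in X + _]mul1r addrC.
exact: measurable_lin.
Qed.

Let iint_sheary t (F : T1 * T1 -> \bar R) :
  measurable_fun [set: T1 * T1] F -> (forall z, 0 <= F z)%E ->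
  iint (F \o sheary t) = iint F.
Proof.
move=> mF F0; apply: eq_integral => x _ /=.
rewrite -(@ge0_integral_shift _ (fun y => F (x, y)) (t * x)%R)//.
by apply: measurableT_comp => //; exact: measurable_pair1.
Qed.

Let iint_shearx t (F : T1 * T1 -> \bar R) :
  measurable_fun [set: T1 * T1] F -> (forall z, 0 <= F z)%E ->
  iint (F \o shearx t) = iint F.
Proof.
move=> mF F0; have mFt := measurableT_comp mF (measurable_shearx t).
rewrite /iint (fubini_tonelli _ mF F0) (fubini_tonelli _ mFt) => [|z /=]; last exact: F0.
apply: eq_integral => y _ /=.
rewrite -(@ge0_integral_shift _ (fun x => F (x, y)) (t * y)%R)//.
by apply: measurableT_comp => //; exact: measurable_pair2.
Qed.

(* A rotation is a product of three shears, each of which preserves the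
   Lebesgue measure of the plane by translation invariance and Tonelli. *)
Let iint_rot c s (F : T1 * T1 -> \bar R) : c ^+ 2 + s ^+ 2 = 1 -> s != 0 ->
  measurable_fun [set: T1 * T1] F -> (forall z, 0 <= F z)%E ->
  iint (F \o rot c s) = iint F.
Proof.
move=> cs1 s0 mF F0.
(* For [c = cos a] and [s = sin a] this is [tan (a / 2)], the coefficient of both horizontal
   shears. *)
pose t := (1 - c) / s.
have -> : F \o rot c s = ((F \o shearx t) \o sheary (- s)) \o shearx t.
  apply/funext => -[x y] /=; congr F; rewrite /rot /shearx /sheary /=.
  have tE : t * s = 1 - c by rewrite /t divfK.
  have tE2 : t * (1 + c) = s.
    by apply: (mulfI s0); rewrite mulrA (mulrC s) tE; move: cs1; lra.
  congr pair.
    transitivity ((1 - t * s) * x + t * (2 - t * s) * y); last by ring.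
    rewrite tE -[in s * y]tE2; ring.
  transitivity (- s * x + (1 - t * s) * y); last by ring.
  by rewrite tE; ring.
have mFx := measurableT_comp mF (measurable_shearx t).
have mFxy := measurableT_comp mFx (measurable_sheary (- s)).
rewrite (iint_shearx _ mFxy); last by move=> z /=.
by rewrite (iint_sheary _ mFx) ?iint_shearx// => z /=.
Qed.

Let gauss2E (C : set (T1 * T1)) : measurable C ->
  (gauss \x gauss)%E C =
  iint (fun z => (\1_C z * (normal_pdf 0 1 z.1 * normal_pdf 0 1 z.2))%:E).
Proof.
move=> mC.
have mI : measurable_fun [set: T1 * T1] (fun z => (\1_C z)%:E : \bar R).
  by apply/measurable_EFinP; exact: measurable_indic.
have I0 z : (0 <= (\1_C z)%:E :> \bar R)%E by rewrite lee_fin.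
transitivity (\int[(gauss \x gauss)%E]_z (\1_C z)%:E)%E.
  have := @integral_indic _ _ R (gauss \x gauss)%E setT measurableT C mC.
  by rewrite setIT => ->.
rewrite fubini_tonelli1// /fubini_F ge0_integral_normal_prob//; last 2 first.
- exact: (measurable_fun_fubini_tonelli_F (m2 := gauss) _ mI I0).
- by move=> x; exact: integral_ge0.
apply: eq_integral => x _.
have mIx : measurable_fun [set: T1] (fun y => (\1_C (x, y))%:E : \bar R).
  exact: (measurableT_comp mI (measurable_pair1 x)).
rewrite ge0_integral_normal_prob//.
rewrite -ge0_integralZr//; last 3 first.
- apply: emeasurable_funM; first exact: mIx.
  by apply/measurable_EFinP; exact: measurable_normal_pdf.
- by move=> y _; rewrite mule_ge0// lee_fin normal_pdf_ge0.
- by rewrite lee_fin normal_pdf_ge0.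
apply: eq_integral => y _ /=.
by rewrite -!EFinM; congr EFin; ring.
Qed.

(** The product density is a function of [x ^+ 2 + y ^+ 2], which a rotation preserves, as it does
    the Lebesgue integral. *)
Lemma gauss2_rot (c s : R) (C : set (T1 * T1)) : c ^+ 2 + s ^+ 2 = 1 -> s != 0 ->
  measurable C ->
  (gauss \x gauss)%E (rot c s @^-1` C) = (gauss \x gauss)%E C.
Proof.
move=> cs1 s0 mC.
have mrC : measurable (rot c s @^-1` C).
  by rewrite -[X in measurable X]setTI; exact: measurable_rot.
rewrite (gauss2E mC) (gauss2E mrC).
rewrite -[RHS](iint_rot cs1 s0); first last.
- by move=> z; rewrite lee_fin !mulr_ge0// normal_pdf_ge0.
- apply/measurable_EFinP; apply: measurable_funM; first exact: measurable_indic.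
  apply: measurable_funM.
    exact: (measurableT_comp (measurable_normal_pdf 0 1) measurable_fst).
  exact: (measurableT_comp (measurable_normal_pdf 0 1) measurable_snd).
congr iint; apply/funext => -[x y] /=.
congr (_ * _)%:E; apply/esym.
rewrite !normal_pdfE ?oner_eq0//= /normal_fun !subr0 mulrACA [RHS]mulrACA -!expRD.
congr (_ * expR _); rewrite -!mulrDl; congr (_ / _).
rewrite -[RHS]mul1r -cs1; ring.
Qed.

End Gauss2.

(** * Standard Gaussian vectors on an event *)

Section StandardOn.
Context (R : realType) (d0 : measure_display) (T : measurableType d0).
Variable P : probability T R.
Notation gauss := (@normal_prob R 0 1).

Definition boxset m (A : 'I_m -> set R) (X : T -> 'cV[R]_m) : set T :=
  [set w | forall k, A k (X w k 0)].

(* Conditionally on the event [B], the coordinates of [X] are independent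
   standard Gaussian variables. *)
Definition std_on (B : set T) m (X : T -> 'cV[R]_m) : Prop :=
  [/\ measurable B, forall k, measurable_fun [set: T] (fun w => X w k 0)
    & forall A : 'I_m -> set R, (forall k, measurable (A k)) ->
      (P (B `&` boxset A X) = P B * \prod_(k < m) gauss (A k))%E].

Lemma measurable_boxset m (X : T -> 'cV[R]_m) (A : 'I_m -> set R) :
  (forall k, measurable_fun [set: T] (fun w => X w k 0)) ->
  (forall k, measurable (A k)) -> measurable (boxset A X).
Proof.
move=> mX mA.
rewrite (_ : boxset A X = \big[setI/setT]_(k < m) ((fun w => X w k 0) @^-1` A k)).
  apply: bigsetI_measurable => k _; rewrite -[X in measurable X]setTI.
  exact: mX.
rewrite -bigcap_seq; apply/seteqP; split => w /= h k.
  by move=> _; exact: h.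
by apply: h => /=; rewrite mem_index_enum.
Qed.

Lemma gauss_setT : gauss setT = 1%E.
Proof. exact: probability_setT. Qed.

Lemma std_on_measurable B m (X : T -> 'cV[R]_m) : std_on B X -> measurable B.
Proof. by case. Qed.

Definition rotv m (a b : 'I_m) (c s : R) (x : 'cV[R]_m) : 'cV[R]_m :=
  \col_k (if k == a then c * x a 0 + s * x b 0
          else if k == b then - s * x a 0 + c * x b 0 else x k 0).

Let mrestrE B (mB : measurable B) C : mrestr P mB C = P (C `&` B).
Proof. by []. Qed.

(** Fix the constraints on the coordinates other than [a] and [b]. Under [P] restricted to these and
    to [B], the pair of coordinates [a], [b] has law [q] times the planar Gaussian measure: the two
    agree on rectangles. That law is rotation invariant. *)
Lemma std_on_rotv B m (X : T -> 'cV[R]_m) a b c s :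
  std_on B X -> a != b -> c ^+ 2 + s ^+ 2 = 1 -> s != 0 ->
  std_on B (fun w => rotv a b c s (X w)).
Proof.
move=> [mB mX sX] ab cs1 s0.
have ba : (b == a) = false by rewrite eq_sym (negbTE ab).
split => [//|k|A mA].
  under eq_fun do rewrite mxE.
  case: (k == a); last case: (k == b); last exact: mX.
  - by apply: measurable_funD; apply: measurable_funM.
  - by apply: measurable_funD; apply: measurable_funM.
pose A' k := if (k == a) || (k == b) then setT else A k.
have mA' k : measurable (A' k) by rewrite /A'; case: ifP.
pose B' := B `&` boxset A' X.
have mB' : measurable B' by apply: measurableI => //; exact: measurable_boxset.
pose q := (P B * \prod_(k < m | (k != a) && (k != b)) gauss (A k))%E.
have q0 : (0 <= q)%E.
  rewrite mule_ge0//; elim/big_ind : _ => // x y x0 y0; exact: mule_ge0.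
have qfin : q \is a fin_num.
  apply: fin_numM; first exact: fin_num_measure.
  apply: prode_fin_num => k _.
  exact: (@fin_num_measure _ _ _ (normal_prob 0 1) (A k) (mA k)).
have mXab : measurable_fun [set: T]
    (fun w => (X w a 0, X w b 0) : measurableTypeR R * measurableTypeR R).
  exact: (measurable_fun_pair (mX a) (mX b)).
pose nu := pushforward (mrestr P mB') (mfun_of mXab).
pose A2 (C D : set R) k := if k == a then C else if k == b then D else A k.
have nuE C D : measurable C -> measurable D ->
    nu (C `*` D) = (q * (gauss C * gauss D))%E.
  move=> mC mD; rewrite /nu /pushforward mrestrE /=.
  rewrite (_ : _ `&` _ = B `&` boxset (A2 C D) X); last first.
    apply/seteqP; split => w /=.
      move=> [[Cw Dw] [Bw Aw]]; split => // k; have := Aw k.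
      by rewrite /A2 /A'; case: eqVneq => [->//|_]; case: eqVneq => [->|].
    move=> [Bw Aw]; split.
      by have := Aw a; have := Aw b; rewrite /A2 eqxx ba eqxx.
    split => // k; have := Aw k; rewrite /A2 /A'.
    by case: (k == a); case: (k == b).
  rewrite sX => [|k]; last by rewrite /A2; case: ifP => // _; case: ifP.
  rewrite (bigD1 a)//= (bigD1 b)/=; last by rewrite eq_sym.
  rewrite /q -!muleA; congr (_ * _)%E.
  rewrite {1 2}/A2 eqxx ba eqxx [RHS]muleC muleA; congr (_ * _)%E.
  by apply: eq_bigr => k /andP[ka kb]; rewrite /A2 (negbTE ka) (negbTE kb).
pose qn := NngNum (fine_ge0 q0).
have nuG Y : measurable Y -> nu Y = (q * (gauss \x gauss)%E Y)%E.
  move=> mY; rewrite -[q in RHS]fineK//.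
  rewrite -[RHS]/(mscale qn (gauss \x gauss)%E Y).
  apply: (measure_unique
    [set C | exists2 A, measurable A & exists2 B, measurable B & A `*` B = C]
    (fun=> setT)) => //.
  - by rewrite measurable_prod_measurableType.
  - move=> _ _ [C1 mC1 [D1 mD1 <-]] [C2 mC2 [D2 mD2 <-]].
    exists (C1 `&` C2); first exact: measurableI.
    by exists (D1 `&` D2); [exact: measurableI|rewrite setXI].
  - by move=> _; exists setT => //; exists setT => //; rewrite setXTT.
  - by rewrite bigcup_const.
  - move=> _ [C mC [D mD <-]].
    apply: etrans (nuE _ _ mC mD) _.
    transitivity (qn%:num%:E * (gauss \x gauss)%E (C `*` D))%E; last by [].
    by rewrite product_measure1E//= fineK.
  - move=> _; rewrite -setXTT; apply: (@le_lt_trans _ _ q); last by rewrite ltey_eq qfin.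
    have := nuE _ _ measurableT measurableT.
    by rewrite !gauss_setT !mule1 => <-.
transitivity (nu (rot c s @^-1` (A a `*` A b))).
  rewrite /nu /pushforward mrestrE; congr (P _); apply/seteqP; split => w /=.
    move=> [Bw Aw]; split; last first.
      split => // k; have := Aw k; rewrite /A' mxE.
      by case: (k == a); case: (k == b).
    have := Aw b; have := Aw a; rewrite !mxE eqxx ba eqxx.
    by [].
  move=> [[Awa Awb] [Bw Aw]]; split => // k; have := Aw k; rewrite /A' mxE.
  by case: eqVneq => [->//|_] /=; case: eqVneq => [->//|_].
have mAab : measurable (A a `*` A b : set (measurableTypeR R * measurableTypeR R)).
  exact: (measurableX (mA a) (mA b)).
rewrite nuG; last first.
  by rewrite -[X in measurable X]setTI; exact: measurable_rot.
have prodE : (gauss \x gauss)%E (A a `*` A b) = (gauss (A a) * gauss (A b))%E.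
  exact: (product_measure1E (normal_prob 0 1) (normal_prob 0 1) (mA a) (mA b)).
rewrite gauss2_rot// prodE (bigD1 a)//= (bigD1 b)/=; last by rewrite eq_sym.
by rewrite /q -!muleA; congr (_ * _)%E; rewrite [LHS]muleC muleA.
Qed.

Lemma std_on_flip B m (X Y : T -> 'cV[R]_m) a : std_on B X ->
  (forall w, Y w a 0 = - X w a 0) -> (forall w k, k != a -> Y w k 0 = X w k 0) ->
  std_on B Y.
Proof.
move=> [mB mX sX] Ya Yk; split => [//|k|A mA].
  have [->|ka] := eqVneq k a.
    under eq_fun do rewrite Ya.
    exact: measurable_funN.
  under eq_fun do rewrite Yk//.
  exact: mX.
pose A' k := if k == a then -%R @^-1` A k else A k.
have mA' k : measurable (A' k).
  rewrite /A'; case: ifP => // _; rewrite -[X in measurable X]setTI.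
  have mN : measurable_fun [set: R] (-%R : R -> R) by exact: measurable_funN.
  exact: mN.
rewrite (_ : boxset A Y = boxset A' X).
  rewrite sX//; congr (_ * _)%E; apply: eq_bigr => k _.
  by rewrite /A'; case: ifP => // _; exact: gaussN.
apply/seteqP; split => w Aw k; have := Aw k; rewrite /A'; case: eqVneq => [->|ka] /=.
- by rewrite Ya.
- by rewrite Yk.
- by rewrite Ya.
- by rewrite Yk.
Qed.

(** For [v] of squared norm [2] this is the orthogonal reflection in the hyperplane normal to [v];
    the normalization cancels the usual factor [2 / |v|^2]. *)
Definition reflv m (v x : 'cV[R]_m) : 'cV[R]_m := x - (v^T *m x) 0 0 *: v.

Let dotE m (v x : 'cV[R]_m) : (v^T *m x) 0 0 = \sum_k v k 0 * x k 0.
Proof. by rewrite mxE; apply: eq_bigr => k _; rewrite mxE. Qed.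

Let rotvK m (a b : 'I_m) c s (x : 'cV[R]_m) : a != b -> c ^+ 2 + s ^+ 2 = 1 ->
  rotv a b c (- s) (rotv a b c s x) = x.
Proof.
move=> ab cs1; have ba : (b == a) = false by rewrite eq_sym (negbTE ab).
apply/colP => k; rewrite !mxE eqxx ba eqxx.
case: eqVneq => [->|_].
  by rewrite -[RHS]mul1r -cs1; ring.
case: eqVneq => [->|_//].
by rewrite -[RHS]mul1r -cs1; ring.
Qed.

Let rotv_linear m (a b : 'I_m) c s t (x y : 'cV[R]_m) :
  rotv a b c s (x - t *: y) = rotv a b c s x - t *: rotv a b c s y.
Proof.
apply/colP => k; rewrite !mxE; case: ifP => _; first by ring.
by case: ifP => _ //; ring.
Qed.

Let rotv_dot m (a b : 'I_m) c s (x y : 'cV[R]_m) : a != b -> c ^+ 2 + s ^+ 2 = 1 ->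
  ((rotv a b c s x)^T *m rotv a b c s y) 0 0 = (x^T *m y) 0 0.
Proof.
move=> ab cs1; have ba : (b == a) = false by rewrite eq_sym (negbTE ab).
rewrite !dotE (bigD1 a)//= (bigD1 b)/=; last by rewrite eq_sym.
rewrite [RHS](bigD1 a)//= [X in _ = _ + X](bigD1 b)/=; last by rewrite eq_sym.
rewrite !addrA; congr (_ + _).
  rewrite !mxE eqxx ba eqxx -[RHS]mul1r -cs1; ring.
by apply: eq_bigr => k /andP[/negbTE ka /negbTE kb]; rewrite !mxE ka kb.
Qed.

(* Plane rotations conjugate the reflection to one whose vector has a smaller
   support, down to the change of sign of a single coordinate. *)
Lemma std_on_reflv B m (v : 'cV[R]_m) (X : T -> 'cV[R]_m) :
  (v^T *m v) 0 0 = 2 -> std_on B X -> std_on B (fun w => reflv v (X w)).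
Proof.
have [n] := ubnP #|[pred k | v k 0 != 0]|.
elim: n => // n IH in v X *; rewrite ltnS => cv v2 sX.
have [a va] : exists a, v a 0 != 0.
  apply/existsP; rewrite -[X in is_true X]negbK negb_exists; apply/negP => /forallP v0.
  have /eqP : (v^T *m v) 0 0 = 0.
    by rewrite dotE big1// => k _; have := v0 k; rewrite negbK => /eqP ->; rewrite mul0r.
  by rewrite v2 pnatr_eq0.
have [/existsP[b /andP[ba vb]]|] := boolP [exists b, (b != a) && (v b 0 != 0)].
  have ab : a != b by rewrite eq_sym.
  pose r := Num.sqrt (v a 0 ^+ 2 + v b 0 ^+ 2).
  have r2 : r ^+ 2 = v a 0 ^+ 2 + v b 0 ^+ 2.
    by rewrite sqr_sqrtr// addr_ge0// sqr_ge0.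
  have r0 : r != 0.
    rewrite gt_eqF// sqrtr_gt0 ltr_wpDl// ?sqr_ge0//.
    by rewrite lt_def sqrf_eq0 vb sqr_ge0.
  (* The rotation that takes the coordinates [(v a, v b)] to [(r, 0)], so that [b] leaves the
     support. *)
  pose c := v a 0 / r; pose s := v b 0 / r.
  have cs1 : c ^+ 2 + s ^+ 2 = 1.
    by rewrite /c /s !expr_div_n -mulrDl -r2 divff// sqrf_eq0.
  have s0 : s != 0 by rewrite mulf_neq0// invr_eq0.
  have -> : (fun w => reflv v (X w)) =
      (fun w => rotv a b c (- s) (reflv (rotv a b c s v) (rotv a b c s (X w)))).
    apply/funext => w; rewrite /reflv rotv_linear !rotvK// rotv_dot//.
  apply: std_on_rotv => //; last 2 first.
  - by rewrite sqrrN.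
  - by rewrite oppr_eq0.
  apply: IH; last exact: std_on_rotv.
  - apply: leq_trans cv; apply: proper_card; apply/properP; split.
      apply/fintype.subsetP => k; rewrite !inE mxE; case: (eqVneq k a) => [->//|_].
      by case: (eqVneq k b) => [->//|_].
    exists b; rewrite !inE// mxE (negbTE ba) eqxx negbK /s /c.
    by apply/eqP; ring.
  - by rewrite rotv_dot.
rewrite negb_exists => /forallP v0.
have {}v0 k : k != a -> v k 0 = 0.
  by move=> ka; have := v0 k; rewrite ka negbK => /eqP.
have dva (x : 'cV[R]_m) : (v^T *m x) 0 0 = v a 0 * x a 0.
  by rewrite dotE (bigD1 a)//= big1 ?addr0// => k ka; rewrite v0// mul0r.
(* With [a] alone in the support, the squared norm [2] forces [x a - v a ^+ 2 * x a = - x a]. *)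
have va2 : v a 0 * v a 0 = 2 by rewrite -dva.
apply: (std_on_flip (a := a) sX) => [w|w k ka]; rewrite /reflv dva !mxE.
  by rewrite mulrAC va2; ring.
by rewrite (v0 k ka) mulr0 subr0.
Qed.

End StandardOn.

(** * Moments and laws of vectors that are standard Gaussian on an event *)

Section Moments.
Context (R : realType) (d0 : measure_display) (T : measurableType d0).
Variable P : probability T R.
Notation gauss := (@normal_prob R 0 1).

(** Integrability is kept with the value, and the integral is not divided by [P B], so that values
    over disjoint events add up. *)
Definition mean_on (B : set T) (h : T -> R) (r : R) : Prop :=
  P.-integrable B (EFin \o h) /\ (\int[P]_(w in B) (h w)%:E = r%:E)%E.

Lemma eq_mean_on B (h h' : T -> R) r : measurable B ->
  (forall w, B w -> h w = h' w) -> mean_on B h r -> mean_on B h' r.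
Proof.
move=> mB hh' [ih eh]; split.
  by apply: eq_integrable ih => // w /set_mem Bw /=; rewrite hh'.
by rewrite -eh; apply: eq_integral => w /set_mem Bw; rewrite hh'.
Qed.

Lemma mean_onD B (h h' : T -> R) r r' : measurable B ->
  mean_on B h r -> mean_on B h' r' -> mean_on B (fun w => h w + h' w) (r + r').
Proof.
move=> mB [ih eh] [ih' eh']; split; first exact: (integrableD mB ih ih').
under eq_integral do rewrite EFinD.
by rewrite (integralD mB ih ih') EFinD; congr (_ + _)%E.
Qed.

Lemma mean_onZ B (h : T -> R) r c : measurable B ->
  mean_on B h r -> mean_on B (fun w => c * h w) (c * r).
Proof.
move=> mB [ih eh]; split; first exact: (integrableZl mB c ih).
under eq_integral do rewrite EFinM.
by rewrite (integralZl mB ih) EFinM; congr (_ * _)%E.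
Qed.

Lemma mean_on_sum (I : eqType) (s : seq I) B (h : I -> T -> R) r : measurable B ->
  (forall i, i \in s -> mean_on B (h i) (r i)) ->
  mean_on B (fun w => \sum_(i <- s) h i w) (\sum_(i <- s) r i).
Proof.
move=> mB; elim: s => [|i s IH] mh.
  rewrite big_nil; apply: (@eq_mean_on _ (cst 0)) => //.
    by move=> w _; rewrite big_nil.
  split; first exact: (@integrable0 _ _ _ P B).
  exact: integral0.
rewrite big_cons; apply: (@eq_mean_on _ (fun w => h i w + \sum_(j <- s) h j w)) => //.
  by move=> w _; rewrite big_cons.
apply: mean_onD => //; first by apply: mh; rewrite mem_head.
by apply: IH => j js; apply: mh; rewrite in_cons js orbT.
Qed.

Lemma mean_on_setT B (h : T -> R) r : measurable B -> mean_on B h r ->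
  mean_on setT (fun w => \1_B w * h w) r.
Proof.
move=> mB [ih eh].
have E : EFin \o (fun w => \1_B w * h w) = ((EFin \o h) \_ B).
  apply/funext => w; rewrite /= patchE indicE.
  by case: (w \in B); rewrite ?mul1r ?mul0r.
split; first by rewrite E; exact: (integrable_mkcond _ mB).1.
rewrite -[LHS]/(\int[P]_w (EFin \o (fun w => \1_B w * h w)%R) w)%E E.
by rewrite -integral_mkcond.
Qed.

Lemma mean_on_cst B k : measurable B -> mean_on B (cst k) (k * fine (P B)).
Proof.
move=> mB; split; first exact: finite_measure_integrable_cst.
rewrite -[LHS]/(\int[P]_(w in B) cst k%:E w)%E integral_cst// EFinM fineK//.
exact: fin_num_measure.
Qed.

Lemma std_on_marginal B m (X : T -> 'cV[R]_m) a C : std_on P B X -> measurable C ->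
  P (B `&` (fun w => X w a 0) @^-1` C) = (P B * gauss C)%E.
Proof.
move=> [mB mX sX] mC.
rewrite (_ : _ @^-1` C = boxset (fun k => if k == a then C else setT) X).
  rewrite sX => [|k]; last by case: ifP.
  congr (_ * _)%E; rewrite (bigD1 a)//= eqxx big1 ?mule1// => k /negbTE ->.
  exact: gauss_setT.
apply/seteqP; split => w /=.
  by move=> Cw k; case: eqVneq => [->|].
by move=> /(_ a); rewrite eqxx.
Qed.

(** Coordinate [a] sends the restriction of [P] to [B] to [P B] times the Gaussian law. *)
Lemma ge0_integral_std_on B m (X : T -> 'cV[R]_m) a (f : R -> \bar R) :
  std_on P B X -> measurable_fun [set: R] f -> (forall x, 0 <= f x)%E ->
  (\int[P]_(w in B) f (X w a 0)%R = P B * \int[gauss]_x f x)%E.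
Proof.
move=> sX mf f0; have [mB mX _] := sX.
have mXa : measurable_fun [set: T] (fun w => X w a 0 : measurableTypeR R) by exact: mX.
have mfX : measurable_fun [set: T] (fun w => f (X w a 0)%R).
  exact: (measurableT_comp mf mXa).
transitivity (\int[mrestr P mB]_(w in B) f (X w a 0)%R)%E.
  apply: eq_measure_integral => A mA AB.
  by rewrite -[RHS]/(P (A `&` B)) setIidl.
transitivity (\int[mrestr P mB]_w f (X w a 0)%R)%E.
  rewrite [RHS](@ge0_negligible_integral _ _ _ _ _ (~` B))//.
  - by rewrite setDE setCK setTI.
  - exact: measurableC.
  - by rewrite -[LHS]/(P (~` B `&` B)) setICl measure0.
transitivity (\int[pushforward (mrestr P mB) (mfun_of mXa)]_x f x)%E.
  by rewrite ge0_integral_pushforward.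
have PB0 : 0 <= fine (P B) by exact: fine_ge0.
transitivity (\int[mscale (NngNum PB0) gauss]_x f x)%E.
  apply: eq_measure_integral => A mA _.
  rewrite -[LHS]/(P (((fun w => X w a 0) @^-1` A) `&` B)) setIC.
  rewrite (std_on_marginal a sX)//.
  by rewrite -[RHS]/((fine (P B))%:E * gauss A)%E fineK// fin_num_measure.
by rewrite ge0_integral_mscale//= fineK// fin_num_measure.
Qed.

Lemma mean_on_std_sqr B m (X : T -> 'cV[R]_m) a : std_on P B X ->
  mean_on B (fun w => X w a 0 ^+ 2) (fine (P B)).
Proof.
move=> sX; have [mB mX _] := sX.
have E : (\int[P]_(w in B) (X w a 0 ^+ 2)%:E = (fine (P B))%:E)%E.
  rewrite (ge0_integral_std_on a (f := fun x => (x ^+ 2)%:E) sX).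
  - by rewrite integral_sqr_gauss mule1 fineK// fin_num_measure.
  - by apply/measurable_EFinP; exact: measurable_funX.
  - by move=> x; rewrite lee_fin sqr_ge0.
split=> //; apply/integrableP; split.
  apply/measurable_EFinP/measurable_funTS; apply: measurable_funX; exact: mX.
rewrite (eq_integral (fun w => (X w a 0 ^+ 2)%:E)); first by rewrite E ltry.
by move=> w _ /=; rewrite ger0_norm// sqr_ge0.
Qed.

(* Polarization by the rotation of angle [pi / 4]. *)
Lemma mean_on_std_cross B m (X : T -> 'cV[R]_m) a b : std_on P B X -> a != b ->
  mean_on B (fun w => X w a 0 * X w b 0) 0.
Proof.
move=> sX ab; have mB := std_on_measurable sX.
have ba : (b == a) = false by rewrite eq_sym (negbTE ab).
pose c : R := (Num.sqrt 2)^-1.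
have c0 : c != 0 by rewrite invr_eq0 gt_eqF// sqrtr_gt0.
have c2 : c ^+ 2 = 2^-1 by rewrite exprVn sqr_sqrtr.
have sY : std_on P B (fun w => rotv a b c c (X w)).
  by apply: std_on_rotv => //; rewrite c2; field.
have ha := mean_on_std_sqr a sY; have hb := mean_on_std_sqr b sY.
have := mean_onD mB (mean_onZ 2^-1 mB ha) (mean_onZ (- 2^-1) mB hb).
rewrite mulNr subrr; apply: eq_mean_on => // w _.
rewrite !mxE eqxx ba eqxx.
transitivity (2 * c ^+ 2 * (X w a 0 * X w b 0)); first by field.
by rewrite c2; field.
Qed.

(** Integrability comes from [|y| <= 1 + y ^+ 2]. The mean vanishes by symmetry: the negative part
    of the coordinate is the positive part of its opposite, which is again standard Gaussian on
    [B]. *)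
Lemma mean_on_std B m (X : T -> 'cV[R]_m) a : std_on P B X ->
  mean_on B (fun w => X w a 0) 0.
Proof.
move=> sX; have [mB mX _] := sX.
have [isq _] := mean_onD mB (mean_on_cst 1 mB) (mean_on_std_sqr a sX).
have iX : P.-integrable B (EFin \o (fun w => X w a 0)).
  apply: le_integrable isq => //.
    by apply/measurable_EFinP/measurable_funTS; exact: mX.
  move=> w Bw /=; rewrite lee_fin [leRHS]ger0_norm ?addr_ge0 ?sqr_ge0//.
  rewrite -real_normK ?num_real//.
  have bnd (y : R) : y <= 1 + y ^+ 2 by nra.
  exact: bnd.
split=> //.
pose Y w : 'cV[R]_m := \col_k (if k == a then - X w k 0 else X w k 0).
have sY : std_on P B Y.
  apply: (std_on_flip (a := a) sX) => [w|w k /negbTE ka]; first by rewrite mxE eqxx.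
  by rewrite mxE ka.
have mpos : measurable_fun [set: R] (fun x : R => (Num.max x 0)%:E).
  by apply/measurable_EFinP; exact: measurable_maxr.
have pos0 (x : R) : (0 <= (Num.max x 0)%:E)%E by rewrite lee_fin le_max lexx orbT.
have hX := ge0_integral_std_on a sX mpos pos0.
have hY := ge0_integral_std_on a sY mpos pos0.
rewrite integralE.
have hXY : (\int[P]_(x in B) ((fun w => (X w a 0)%:E)^\- x) =
    \int[P]_(x in B) ((fun w => (X w a 0)%:E)^\+ x))%E.
  transitivity (\int[P]_(w in B) (Num.max (Y w a 0) 0)%:E)%E.
    by apply: eq_integral => w _; rewrite funenegE /Y mxE eqxx -EFinN -EFin_max.
  rewrite hY -hX; apply: eq_integral => w _.
  by rewrite funeposE -EFin_max.
rewrite hXY subee//; apply: integrable_pos_fin_num => //.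
Qed.

Lemma mean_on_std_mulmx B m p (X : T -> 'cV[R]_m) (A : 'M[R]_(p, m)) i :
  std_on P B X -> mean_on B (fun w => (A *m X w) i 0) 0.
Proof.
move=> sX; have mB := std_on_measurable sX.
apply: (@eq_mean_on _ (fun w => \sum_k A i k * X w k 0)) => //.
  by move=> w _; rewrite mxE.
rewrite [X in mean_on _ _ X](_ : 0 = \sum_(k < m) A i k * 0); last first.
  by rewrite big1// => k; rewrite mulr0.
apply: (@mean_on_sum _ _ B (fun k w => A i k * X w k 0)) => // k _.
by apply: mean_onZ => //; exact: mean_on_std.
Qed.

Lemma mean_on_std_mulmx2 B m p q (X : T -> 'cV[R]_m) (A : 'M[R]_(p, m))
    (A' : 'M[R]_(q, m)) i j :
  std_on P B X ->
  mean_on B (fun w => (A *m X w) i 0 * (A' *m X w) j 0)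
    (fine (P B) * (A *m A'^T) i j).
Proof.
move=> sX; have mB := std_on_measurable sX.
apply: (@eq_mean_on _ (fun w => \sum_k \sum_l A i k * A' j l * (X w k 0 * X w l 0))) => //.
  move=> w _; rewrite !mxE big_distrlr/=; apply: eq_bigr => k _.
  by apply: eq_bigr => l _; ring.
rewrite [X in mean_on _ _ X](_ : _ * _ = \sum_(k < m) \sum_(l < m) A i k * A' j l *
    (if k == l then fine (P B) else 0)).
  apply: (@mean_on_sum _ _ B
    (fun k w => \sum_l A i k * A' j l * (X w k 0 * X w l 0))) => // k _.
  apply: (@mean_on_sum _ _ B
    (fun l w => A i k * A' j l * (X w k 0 * X w l 0))) => // l _.
  apply: (@mean_onZ B (fun w => X w k 0 * X w l 0)) => //.
  case: eqVneq => [->|kl]; last exact: mean_on_std_cross.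
  exact: mean_on_std_sqr.
rewrite mxE mulr_sumr; apply: eq_bigr => k _.
rewrite (bigD1 k)//= eqxx big1 ?addr0 => [|l /negbTE]; last first.
  by rewrite eq_sym => ->; rewrite mulr0.
by rewrite mxE mulrC.
Qed.

Lemma measurable_tup m (X : T -> 'cV[R]_m) :
  (forall k, measurable_fun [set: T] (fun w => X w k 0)) ->
  measurable_fun [set: T] (fun w => tup (X w)).
Proof.
move=> mX; apply/measurable_fun_tnthP => k.
rewrite (_ : _ \o _ = fun w => X w k 0); first exact: mX.
by apply/funext => w; rewrite /= tnth_mktuple.
Qed.

Definition tuple_boxes m : set (set (m.-tuple R)) :=
  [set E | exists2 A : 'I_m -> set R,
    forall k, measurable (A k) & E = [set t | forall k, A k (tnth t k)]].

Lemma measurable_tuple_boxes m :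
  @measurable _ (m.-tuple R) = <<s @tuple_boxes m >>.
Proof.
apply/seteqP; split.
  apply: smallest_sub; first exact: smallest_sigma_algebra.
  rewrite -bigcup_seq/=; apply: bigcup_sub => k _ E [C mC <-].
  apply: sub_sigma_algebra; exists (fun l => if l == k then C else setT).
    by move=> l; case: ifP.
  rewrite setTI; apply/seteqP; split => t /= h.
    by move=> l; case: eqVneq => [->|].
  by have := h k; rewrite eqxx.
apply: smallest_sub; first exact: sigma_algebra_measurable.
move=> _ [A mA ->].
rewrite (_ : [set t | _] =
    \big[setI/setT]_(k < m) ((fun t : m.-tuple R => tnth t k) @^-1` A k)).
  apply: bigsetI_measurable => k _; rewrite -[X in measurable X]setTI.
  exact: (measurable_tnth k).
rewrite -bigcap_seq; apply/seteqP; split => w /= h k.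
  by move=> _; exact: h.
by apply: h => /=; rewrite mem_index_enum.
Qed.

(** Boxes form a pi-system that generates the sigma-algebra of tuples, and there both sides are
    [P B] times the same product. [Z] supplies the reference Gaussian law on [R^m]. *)
Lemma std_on_law B m (X Z : T -> 'cV[R]_m) (E : set (m.-tuple R)) :
  std_on P B X -> std_on P setT Z -> measurable E ->
  P (B `&` (fun w => tup (X w)) @^-1` E) = (P B * P ((fun w => tup (Z w)) @^-1` E))%E.
Proof.
move=> sX sZ mE; have [mB mX pX] := sX; have [_ mZ pZ] := sZ.
have mtX := measurable_tup mX; have mtZ := measurable_tup mZ.
have PB0 : 0 <= fine (P B) by exact: fine_ge0.
rewrite setIC -[P B]fineK ?fin_num_measure//.
pose m1 : {measure set (m.-tuple R) -> \bar R} :=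
  pushforward (mrestr P mB) (mfun_of mtX).
pose m2 : {measure set (m.-tuple R) -> \bar R} :=
  mscale (NngNum PB0) (pushforward P (mfun_of mtZ)).
rewrite -[LHS]/(m1 mtX E) -[RHS]/(m2 mtZ E).
apply: (@measure_unique _ R _ (@tuple_boxes m) (fun=> setT)) => //.
- exact: measurable_tuple_boxes.
- move=> _ _ [A1 mA1 ->] [A2 mA2 ->]; exists (fun k => A1 k `&` A2 k).
    by move=> k; exact: measurableI.
  apply/seteqP; split => t /=; first by move=> [h1 h2] k; split.
  by move=> h; split => k; have [] := h k.
- by move=> _; exists (fun=> setT) => //; apply/seteqP; split.
- by rewrite bigcup_const.
- move=> _ [A mA ->].
  rewrite -[LHS]/(P (_ `&` B)) -[RHS]/(_ * P _)%E setIC.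
  have preE (Y : T -> 'cV[R]_m) :
      (fun w => tup (Y w)) @^-1` [set t | forall k, A k (tnth t k)] = boxset A Y.
    by apply/seteqP; split => w h k; have := h k; rewrite /= tnth_mktuple.
  have := pX A mA; have := pZ A mA; rewrite setTI probability_setT mul1e !preE => -> ->.
  by rewrite fineK// fin_num_measure.
- move=> _; rewrite -[ltLHS]/(P _) -ge0_fin_numE//.
  by apply: fin_num_measure; rewrite setTI.
Qed.

End Moments.

(** * Words of indices and products of projections *)

Section Words.
Context (R : realType) (d : nat) (V S : 'M[R]_d).
Hypothesis S_sym : S^T = S.
Hypothesis SS : S *m S = V.
Hypothesis V_diag : forall k, V k k = 1.

Local Notation f := (fvec S).
Local Notation Pk := (Pproj S).

Lemma fvec_norm k : ((f k)^T *m f k) = 1%:M.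
Proof.
rewrite /fvec trmx_mul S_sym !mulmxA -(mulmxA _ S S) SS.
apply/matrixP => a b.
by rewrite !ord1 /ecol trmx_delta -rowE -colE !mxE V_diag.
Qed.

Lemma Pproj_sym k : (Pk k)^T = Pk k.
Proof. by rewrite /Pproj linearB/= trmx1 trmx_mul trmxK. Qed.

Lemma Pproj_fvec k : Pk k *m f k = 0.
Proof. by rewrite /Pproj mulmxBl mul1mx -mulmxA fvec_norm mulmx1 subrr. Qed.

Lemma Pproj_idem k : Pk k *m Pk k = Pk k.
Proof. by rewrite {2}/Pproj mulmxBr mulmx1 mulmxA Pproj_fvec mul0mx subr0. Qed.

Lemma sum_fvec : \sum_k f k *m (f k)^T = V.
Proof.
under eq_bigr do rewrite /fvec trmx_mul S_sym mulmxA -(mulmxA S).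
rewrite -mulmx_suml -mulmx_sumr -[RHS]SS; congr (_ *m _).
rewrite -[RHS]mulmx1; congr (_ *m _); apply/matrixP => a b.
rewrite summxE (bigD1 a)//= big1 => [|k ka].
  by rewrite addr0 !mxE big_ord1 !mxE !eqxx mul1r andbT eq_sym.
by rewrite !mxE big_ord1 !mxE eq_sym (negbTE ka) mul0r.
Qed.

(* Words list the most recent index first. *)
Fixpoint words (n : nat) : seq (seq 'I_d) :=
  if n is n'.+1 then [seq k :: s | s <- words n', k <- enum 'I_d] else [:: [::]].

Lemma size_words n s : s \in words n -> size s = n.
Proof.
elim: n s => [|n IH] s /=; first by rewrite inE => /eqP ->.
by move=> /allpairsP[[t k] /= [/IH <- _ ->]].
Qed.

Lemma mem_words n s : size s = n -> s \in words n.
Proof.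
elim: n s => [|n IH] [|k s]//= [/IH sn].
by apply/allpairsP; exists (s, k); rewrite mem_enum.
Qed.

Lemma uniq_words n : uniq (words n).
Proof.
elim: n => //= n IH; apply: allpairs_uniq => //; first exact: enum_uniq.
by move=> [s k] [s' k'] _ _ /= [-> ->].
Qed.

Fixpoint Mword (s : seq 'I_d) : 'M[R]_d :=
  if s is k :: s' then Pk k *m Mword s' else 1%:M.

Section Noise.
Variable N : nat.

(** The row basis vector of index [j]. Taking [j] in [nat] keeps bound proofs out of [Rword]; the
    row is zero once [j >= N]. *)
Definition noise_row (j : nat) : 'rV[R]_N := \row_l (l == j :> nat)%:R.

(** The coefficients of the noise in the chain started from zero. The head letter is the most recent
    one, so its noise has index [size s'], the number of earlier steps. *)
Fixpoint Rword (s : seq 'I_d) : 'M[R]_(d, N) :=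
  if s is k :: s' then Pk k *m Rword s' + f k *m noise_row (size s') else 0.

Lemma noise_row_mul (j : nat) (jN : (j < N)%N) (x : 'cV[R]_N) :
  noise_row j *m x = (x (Ordinal jN) 0)%:M.
Proof.
apply/matrixP => a b; rewrite !ord1 !mxE (bigD1 (Ordinal jN))//= big1 => [|l lj].
  by rewrite mxE eqxx mul1r addr0.
by rewrite mxE (_ : _ == _ = false) ?mul0r//; apply: contraNF lj.
Qed.

Lemma noise_row_orth (j l : nat) : (j < N)%N -> noise_row j *m (noise_row l)^T = (j == l)%:R%:M.
Proof. by move=> jN; rewrite (noise_row_mul jN) !mxE. Qed.

(** Only noises of index below [size s] have entered, so the next one is fresh. *)
Lemma Rword_noise (s : seq 'I_d) (j : nat) :
  (size s <= N)%N -> (size s <= j)%N -> Rword s *m (noise_row j)^T = 0.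
Proof.
elim: s => [|k s IH] /= sN sj; first by rewrite mul0mx.
rewrite mulmxDl -!mulmxA IH ?(ltnW sN) ?(ltnW sj)// noise_row_orth//.
by rewrite ltn_eqF// mulr0n -scalemx1 scale0r !mulmx0 addr0.
Qed.

(** This says that the identity covariance is stationary. The cross terms vanish because the fresh
    noise is orthogonal to the rows of [Rword s], and the inductive step reduces to
    [P_k I P_k + f_k f_k^T = I]. *)
Lemma Mword_Rword (s : seq 'I_d) : (size s <= N)%N ->
  Mword s *m (Mword s)^T + Rword s *m (Rword s)^T = 1%:M.
Proof.
elim: s => [|k s IH] sN /=; first by rewrite trmx1 mulmx1 mul0mx addr0.
have := Pproj_sym k; have := Pproj_idem k; have : Pk k + f k *m (f k)^T = 1%:M.
  by rewrite /Pproj subrK.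
have := Rword_noise (ltnW sN) (leqnn _); have := noise_row_orth (size s) sN.
rewrite eqxx; move: (noise_row _) (Rword s) {IH}(IH (ltnW sN)) => e Q MQ ee Qe.
move: (Pk k) (f k) => p x px pp pT.
rewrite linearD/= !trmx_mul pT mulmxDl !mulmxDr.
have E : p *m Q *m (e^T *m x^T) = 0 by rewrite -mulmxA (mulmxA Q) Qe mul0mx mulmx0.
have E' : x *m e *m (Q^T *m p) = 0.
  by apply: trmx_inj; rewrite !trmx_mul trmxK pT E trmx0.
rewrite E E' addr0 add0r addrA.
rewrite -[X in _ + X]mulmxA (mulmxA e) ee mul1mx.
by rewrite -!(mulmxA p) -mulmxDr !(mulmxA _ _ p) -mulmxDl MQ mul1mx pp.
Qed.

End Noise.

(** * The averaging operator and its traces *)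

Definition Lop (A : 'M[R]_d) : 'M[R]_d := d%:R^-1 *: \sum_k Pk k *m A *m Pk k.

Lemma Lop_linear c A B : Lop (A - c *: B) = Lop A - c *: Lop B.
Proof.
rewrite /Lop scalerA mulrC -scalerA -scalerBr; congr (_ *: _); rewrite scaler_sumr -sumrB.
apply: eq_bigr => k _.
by move: (Pk k) => p; rewrite mulmxBr mulmxBl -scalemxAr -scalemxAl.
Qed.

Lemma Lop1 : (0 < d)%N -> Lop 1%:M = 1%:M - d%:R^-1 *: V.
Proof.
move=> d0; rewrite /Lop.
under eq_bigr do rewrite mulmx1 Pproj_idem /Pproj.
rewrite sumrB sum_fvec scalerBr sumr_const card_ord -[1%:M *+ d]scaler_nat scalerA mulVf ?scale1r//.
by rewrite pnatr_eq0 -lt0n.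
Qed.

Let quad (A : 'M[R]_d) := forall x : 'cV[R]_d, 0 <= (x^T *m A *m x) 0 0.

Lemma Lop_quad A : quad A -> quad (Lop A).
Proof.
move=> qA x; rewrite /Lop -scalemxAr -scalemxAl mxE mulr_ge0 ?invr_ge0//.
rewrite mulmx_sumr mulmx_suml summxE sumr_ge0// => k _.
have := qA (Pk k *m x); rewrite trmx_mul Pproj_sym !mulmxA; exact.
Qed.

Lemma iter_Lop_quad A n : quad A -> quad (iter n Lop A).
Proof. by move=> qA; elim: n => //= n IH; exact: Lop_quad. Qed.

Lemma quad_trace A : quad A -> 0 <= \tr A.
Proof.
move=> qA; rewrite /mxtrace sumr_ge0// => k _.
have := qA (ecol R k); rewrite /ecol trmx_delta -rowE -colE !mxE; exact.
Qed.

(** By cyclicity and idempotence [tr (P_k A P_k) = tr A - f_k^T A f_k], and the subtracted term is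
    non-negative. *)
Lemma trace_Lop_le A : quad A -> \tr (Lop A) <= \tr A.
Proof.
move=> qA; rewrite /Lop mxtraceZ raddf_sum/=.
have [d0|d0] := posnP d.
  by rewrite /mxtrace !big1 ?mulr0//; case=> k kd; exfalso; rewrite d0 in kd.
apply: (@le_trans _ _ (d%:R^-1 * \sum_(k < d) \tr A)); last first.
  by rewrite sumr_const card_ord -[\tr A *+ d]mulr_natl mulrA mulVf ?mul1r// pnatr_eq0 -lt0n.
rewrite ler_wpM2l ?invr_ge0// ler_sum// => k _.
rewrite mxtrace_mulC mulmxA Pproj_idem /Pproj mulmxBl mul1mx raddfB/= gerBl.
by rewrite -mulmxA mxtrace_mulC /mxtrace big_ord1.
Qed.

(** This number is [E |M_n|^2], as [mean_mnorm] shows for uniform indices. *)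
Definition Mtrace n : R := \tr (iter n Lop V).

(** The head letter is the leftmost factor of [Mword], hence adjacent to [A]; averaging over it
    turns [A] into [Lop A]. The induction therefore runs over all [A]. *)
Lemma sum_words (n : nat) (A : 'M[R]_d) : (0 < d)%N ->
  \sum_(s <- words n) d%:R ^- n * \tr ((Mword s)^T *m A *m Mword s) =
  \tr (iter n Lop A).
Proof.
move=> d0; elim: n A => [|n IH] A.
  by rewrite big_seq1 /= invr1 mul1r trmx1 mul1mx mulmx1.
rewrite iterSr -IH /= big_allpairs_dep/=; apply: eq_bigr => s _.
rewrite big_enum/= -mulr_sumr exprSr invfM -mulrA; congr (_ * _).
rewrite /Lop -scalemxAr -scalemxAl mxtraceZ; congr (_ * _).
rewrite mulmx_sumr mulmx_suml raddf_sum/=; apply: eq_bigr => k _.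
by rewrite trmx_mul Pproj_sym !mulmxA.
Qed.

Lemma V_quad : quad V.
Proof.
move=> x; rewrite -SS mulmxA -{1}S_sym -trmx_mul -mulmxA mxE sumr_ge0// => k _.
by rewrite mxE -expr2 sqr_ge0.
Qed.

Lemma Mtrace_noninc n : Mtrace n.+1 <= Mtrace n.
Proof. exact/trace_Lop_le/iter_Lop_quad/V_quad. Qed.

Lemma iter_Lop_linear n c A B :
  iter n Lop (A - c *: B) = iter n Lop A - c *: iter n Lop B.
Proof. by elim: n => //= n ->; rewrite Lop_linear. Qed.

(* [Lop 1 = 1 - V / d] makes the sum telescope. *)
Lemma sum_Mtrace n : (0 < d)%N -> \sum_(j < n) Mtrace j <= d%:R ^+ 2.
Proof.
move=> d0; have dn0 : d%:R != 0 :> R by rewrite pnatr_eq0 -lt0n.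
suff -> : \sum_(j < n) Mtrace j = d%:R * (d%:R - \tr (iter n Lop 1%:M)).
  rewrite expr2 ler_wpM2l// gerBl; apply/quad_trace/iter_Lop_quad => x.
  by rewrite mulmx1 mxE sumr_ge0// => k _; rewrite mxE -expr2 sqr_ge0.
elim: n => [|n IH]; first by rewrite big_ord0 /= mxtrace1 subrr mulr0.
rewrite big_ord_recr/= IH -iterS iterSr Lop1// iter_Lop_linear raddfB/= mxtraceZ.
by rewrite /Mtrace; field.
Qed.

(** A non-increasing sequence lies below the average of its earlier terms, here the [n] terms of
    index [j < n], whose sum is at most [d ^ 2]. *)
Lemma Mtrace_le n : (0 < d)%N -> (0 < n)%N -> Mtrace n <= d%:R ^+ 2 / n%:R.
Proof.
move=> d0 n0; rewrite ler_pdivlMr ?ltr0n//.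
apply: le_trans (sum_Mtrace n d0).
have -> : Mtrace n * n%:R = \sum_(j < n) Mtrace n.
  by rewrite sumr_const card_ord mulr_natr.
have noninc : {homo Mtrace : j l / (j <= l)%N >-> l <= j}.
  exact: (homo_leq (r := fun x y => y <= x) (@lexx _ _)
    (fun y x z xy yz => le_trans yz xy) Mtrace_noninc).
by rewrite ler_sum// => j _; apply: noninc; exact: ltnW.
Qed.

Lemma trace_Mword s : \tr ((Mword s)^T *m V *m Mword s) =
  \sum_k (S *m Mword s *m (S *m Mword s)^T) k k.
Proof.
rewrite -SS mulmxA -{1}S_sym -trmx_mul -mulmxA mxtrace_mulC.
by [].
Qed.

Lemma mnormE s : mnorm V (Mword s) ^+ 2 = \tr ((Mword s)^T *m V *m Mword s).
Proof.
rewrite /mnorm sqr_sqrtr// trace_Mword sumr_ge0// => k _.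
by rewrite mxE sumr_ge0// => l _; rewrite [X in _ * X]mxE -expr2 sqr_ge0.
Qed.

(** * The chain as a linear function of the noise *)

Section Process.
Context (T : Type) (i : nat -> T -> 'I_d) (g : nat -> T -> R).

Fixpoint word_at n (w : T) : seq 'I_d :=
  if n is n'.+1 then i n' w :: word_at n' w else [::].

Lemma size_word_at n w : size (word_at n w) = n.
Proof. by elim: n => //= n ->. Qed.

Lemma Mprod_word n w : Mprod S i n w = Mword (word_at n w).
Proof. by elim: n => //= n ->. Qed.

Definition noise N w : 'cV[R]_N := \col_j g j w.

(** The identities [S f_k = V e_k] and [f_k^T U = e_k^T (S U)] make the update of [X] the image
    under [S] of the update of [U]. The length [N] stays fixed while [n] varies, so one noise vector
    serves the whole induction. *)
Lemma Xproc_word N n w : (n <= N)%N ->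
  Xproc V i g n w = S *m (Rword N (word_at n w) *m noise N w).
Proof.
elim: n => [|n IH] nN /=; first by rewrite mul0mx mulmx0.
rewrite IH ?(ltnW nN)// mulmxDl size_word_at -(mulmxA (f _)).
rewrite (noise_row_mul nN) [noise _ _ _ _]mxE/=.
set U := Rword _ _ *m _.
rewrite -mulmxA -/U /Pproj mulmxBl mul1mx -(mulmxA (f _)) mulmxDr mulmxBr.
have Sf k : S *m f k = V *m ecol R k by rewrite /fvec mulmxA SS.
have fU k : (f k)^T *m U = ((ecol R k)^T *m (S *m U)) by rewrite /fvec trmx_mul S_sym mulmxA.
rewrite fU [(ecol R _)^T *m (S *m U)]mx11_scalar !mul_mx_scalar -!scalemxAr Sf.
by rewrite [_%:M 0 0]mxE eqxx mulr1n scalerBl -addrA; congr (_ + _); rewrite addrC.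
Qed.

End Process.
End Words.

(** * Preservation of the Gaussian law along a word *)

Section WordStd.
Context (R : realType) (d : nat) (V S : 'M[R]_d).
Hypothesis S_sym : S^T = S.
Hypothesis SS : S *m S = V.
Hypothesis V_diag : forall k, V k k = 1.
Context (d0 : measure_display) (T : measurableType d0) (P : probability T R).

Lemma std_on_usubmx B p q (X : T -> 'cV[R]_(p + q)) :
  std_on P B X -> std_on P B (fun w => usubmx (X w)).
Proof.
move=> [mB mX sX]; split => [//|k|A mA].
  by under eq_fun do rewrite mxE; exact: mX.
pose A' (k : 'I_(p + q)) := if fintype.split k is inl k' then A k' else setT.
have mA' k : measurable (A' k) by rewrite /A'; case: fintype.split.
rewrite (_ : boxset A _ = boxset A' X).
  rewrite sX// big_split_ord/= [X in (_ * (_ * X))%E]big1 => [|k _]; last first.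
    by rewrite /A' (unsplitK (inr k)) gauss_setT.
  by rewrite mule1; congr (_ * _)%E; apply: eq_bigr => k _; rewrite /A' (unsplitK (inl k)).
apply/seteqP; split => w h k.
  rewrite /A'; case: splitP => // k' kk'; have := h k'; rewrite mxE.
  by congr (A _ (X w _ _)); exact: val_inj.
by have := h (lshift q k); rewrite /A' (unsplitK (inl k)) mxE.
Qed.

(* The reflection along [col_mx f_k (- e_j)], with [j] the length of the word,
   sends the pair of the current vector [U] and the fresh noise [g_j] to
   [P_k U + g_j f_k] and to a spent coordinate. *)
Lemma std_on_word B N (Z : T -> 'cV[R]_d) (G : T -> 'cV[R]_N) (s : seq 'I_d) :
  (size s <= N)%N -> std_on P B (fun w => col_mx (Z w) (G w)) ->
  exists D : T -> 'cV[R]_N,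
    (forall w (j : 'I_N), (size s <= j)%N -> D w j 0 = G w j 0) /\
    std_on P B (fun w => col_mx (Mword S s *m Z w + Rword S N s *m G w) (D w)).
Proof.
elim: s => [|k s IH] /= sN sZG.
  exists G; split=> //; rewrite (_ : (fun w => _) = fun w => col_mx (Z w) (G w))//.
  by apply/funext => w; rewrite mul1mx mul0mx addr0.
have [D [DG sD]] := IH (ltnW sN) sZG.
pose e := noise_row R N (size s); pose v := col_mx (fvec S k) (- e^T).
have v2 : (v^T *m v) 0 0 = 2.
  rewrite /v tr_col_mx mul_row_col (fvec_norm S_sym SS V_diag).
  rewrite [(- e^T)^T]linearN/= trmxK mulNmx mulmxN opprK.
  by rewrite noise_row_orth// eqxx !mxE.
pose U w := Mword S s *m Z w + Rword S N s *m G w.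
pose t w : R := (v^T *m col_mx (U w) (D w)) 0 0.
(* In the noise block the reflection alters the coordinate [size s] only, so the later noises remain
   those of [G]. *)
exists (fun w => D w + t w *: e^T); split.
  move=> w j sj; rewrite !mxE DG ?(ltnW sj)//.
  by rewrite (_ : _ == _ = false) ?mulr0 ?addr0// gtn_eqF.
have := std_on_reflv v2 sD.
congr std_on; apply/funext => w.
rewrite /reflv -/(U w) -/(t w) {1}/v scale_col_mx opp_col_mx add_col_mx scalerN opprK.
congr col_mx; rewrite -/(U w).
(* The first block then becomes [U - t f_k = U - (f_k^T U) f_k + g_j f_k], the update of the
   chain. *)
have tE : t w = ((fvec S k)^T *m U w) 0 0 - G w (Ordinal sN) 0.
  rewrite /t /v tr_col_mx mul_row_col [(- e^T)^T]linearN/= trmxK mulNmx (noise_row_mul sN).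
  by rewrite !mxE DG// mulr1n.
rewrite tE mulmxDl -(mulmxA (fvec S k)) (noise_row_mul sN).
rewrite -(mulmxA (Pproj S k) (Mword S s)) -(mulmxA (Pproj S k) (Rword S N s)).
rewrite addrA -mulmxDr -/(U w) /Pproj mulmxBl mul1mx -(mulmxA (fvec S k)).
rewrite [_^T *m U w]mx11_scalar !mul_mx_scalar [_%:M 0 0]mxE eqxx mulr1n.
by rewrite scalerBl opprB addrA addrAC.
Qed.

End WordStd.

(** * The sampler and its stationary coupling *)

Section Independence.
Context (R : realType) (d : nat) (d0 : measure_display) (T : measurableType d0).
Variables (P : probability T R) (i : nat -> T -> 'I_d) (g : nat -> T -> R)
  (Z0 : T -> 'cV[R]_d).

(** A name for the family of events spelled out in the theorem, so that its independence hypothesis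
    applies by conversion. *)
Definition source_events (j : (nat + nat + 'I_d)%type) : set (set T) :=
  match j with
  | inl (inl n) => [set B | exists A : set 'I_d, B = i n @^-1` A]
  | inl (inr n) => [set B | exists2 A : set R, measurable A & B = g n @^-1` A]
  | inr k => [set B | exists2 A : set R, measurable A &
                       B = (fun w => Z0 w k 0) @^-1` A]
  end.

Hypothesis i_measurable : forall n (A : set 'I_d), measurable (i n @^-1` A).
Hypothesis g_measurable : forall n, measurable_fun setT (g n).
Hypothesis Z0_measurable : forall k, measurable_fun setT (fun w => Z0 w k 0).
Hypothesis i_uniform : forall n k, P (i n @^-1` [set k]) = ((d%:R)^-1)%:E.
Hypothesis g_gauss : forall n A, measurable A -> P (g n @^-1` A) = normal_prob 0 1 A.
Hypothesis Z0_gauss : forall k A, measurable A ->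
  P ((fun w => Z0 w k 0) @^-1` A) = normal_prob 0 1 A.
Hypothesis indep : mutually_independent P source_events.

Definition word_event (s : seq 'I_d) : set T := [set w | word_at i (size s) w = s].

Lemma word_event_cons k s :
  word_event (k :: s) = i (size s) @^-1` [set k] `&` word_event s.
Proof.
by apply/seteqP; split => w; [move=> [ik e]; split|move=> [/= ik e]; congr cons].
Qed.

Lemma measurable_word_event s : measurable (word_event s).
Proof.
elim: s => [|k s IH]; last by rewrite word_event_cons; exact: measurableI.
rewrite (_ : word_event _ = setT); first exact: measurableT.
by apply/seteqP; split.
Qed.

(** Each letter is one more event of the independent family: the induction moves the head letter
    from the word into [J], where [F'] assigns it its event. The side condition on [J] keeps the
    family free of repetitions. *)
Lemma indep_word_event s (J : seq (nat + nat + 'I_d)%type) (F : _ -> set T) :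
  uniq J -> (forall j, j \in J -> source_events j (F j)) ->
  (forall j, (j < size s)%N -> inl (inl j) \notin J) ->
  P (word_event s `&` \big[setI/setT]_(j <- J) F j) =
  ((d%:R ^- size s)%:E * \prod_(j <- J) P (F j))%E.
Proof.
elim: s J F => [|k s IH] J F uJ EJ nJ.
  rewrite (_ : word_event _ = setT); last by apply/seteqP; split.
  by rewrite setTI expr0 invr1 mul1e; exact: indep.
pose j0 : (nat + nat + 'I_d)%type := inl (inl (size s)).
have j0J : j0 \notin J by exact: nJ.
pose F' j := if j == j0 then i (size s) @^-1` [set k] else F j.
have F'J j : j \in J -> F' j = F j.
  by move=> jJ; rewrite /F'; case: eqVneq => // jj0; rewrite -jj0 jJ in j0J.
have F'j0 : F' j0 = i (size s) @^-1` [set k] by rewrite /F' eqxx.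
have := IH (j0 :: J) F'; rewrite !big_cons !F'j0.
rewrite (eq_big_seq _ F'J) (eq_big_seq (fun j => P (F j))); last first.
  by move=> j jJ; rewrite F'J.
move=> IH'; rewrite word_event_cons [_ `&` word_event s]setIC -setIA IH'.
- by rewrite i_uniform muleA -EFinM /= exprS invfM [_ * d%:R^-1]mulrC.
- by rewrite /= j0J.
- move=> j; rewrite in_cons => /orP[/eqP ->|jJ]; last by rewrite F'J//; exact: EJ.
  by rewrite F'j0; exists [set k].
- move=> j js; rewrite in_cons negb_or nJ ?andbT; last by rewrite /= ltnW.
  by apply/eqP => -[jE]; rewrite jE ltnn in js.
Qed.

Lemma prob_word_event s : P (word_event s) = (d%:R ^- size s)%:E.
Proof.
have := @indep_word_event s [::] (fun=> setT); rewrite !big_nil setIT mule1.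
by apply.
Qed.

Lemma std_on_word_event N s :
  std_on P (word_event s) (fun w => col_mx (Z0 w) (noise g N w)).
Proof.
split; first exact: measurable_word_event.
  move=> k; rewrite -(splitK k); case: (fintype.split k) => k' /=.
    by under eq_fun do rewrite col_mxEu; exact: Z0_measurable.
  by under eq_fun do rewrite col_mxEd mxE; exact: g_measurable.
move=> A mA.
pose J : seq (nat + nat + 'I_d)%type :=
  [seq inr k | k <- enum 'I_d] ++ [seq inl (inr (val j)) | j <- enum 'I_N].
(* The default [setT] is met only outside [J]: at the random indices and at noises of index [N] or
   more. *)
pose F (x : (nat + nat + 'I_d)%type) : set T := match x with
  | inl (inl _) => setT
  | inl (inr j) => if insub j is Some o then g j @^-1` A (rshift d (o : 'I_N)) else setT
  | inr k => (fun w => Z0 w k 0) @^-1` A (lshift N k)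
  end.
have uJ : uniq J.
  rewrite cat_uniq; apply/and3P; split.
  - by rewrite map_inj_uniq ?enum_uniq// => j k [].
  - by apply/hasPn => _ /mapP[k _ ->]; apply/negP => /mapP[].
  - by rewrite map_inj_uniq ?enum_uniq// => j k [] /val_inj.
have EJ j : j \in J -> source_events j (F j).
  rewrite mem_cat => /orP[] /mapP[k _ ->] /=.
    by exists (A (lshift N k)).
  by rewrite valK; exists (A (rshift d k)).
have nJ j : (j < size s)%N -> inl (inl j) \notin J.
  by move=> _; rewrite mem_cat negb_or; apply/andP; split; apply/negP => /mapP[].
have := indep_word_event uJ EJ nJ.
have -> : (\prod_(j <- J) P (F j) = \prod_(k < d + N) normal_prob 0 1 (A k))%E.
  rewrite big_cat big_split_ord; congr (_ * _)%E; rewrite big_map big_enum.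
    by apply: eq_bigr => k _; exact: Z0_gauss.
  by apply: eq_bigr => k _; rewrite /= valK; exact: g_gauss.
rewrite prob_word_event => <-.
  congr (P (_ `&` _)); rewrite -bigcap_seq; apply/seteqP; split => w /= h.
    move=> j; rewrite /= mem_cat => /orP[] /mapP[k _ ->] /=.
      by have := h (lshift N k); rewrite col_mxEu.
    by rewrite valK; have := h (rshift d k); rewrite col_mxEd mxE.
  move=> k; rewrite -(splitK k); case: (fintype.split k) => k' /=.
    rewrite col_mxEu; apply: (h (inr k')); by rewrite /= mem_cat map_f ?mem_enum.
  rewrite col_mxEd mxE; have := h (inl (inr (val k'))); rewrite /= valK; apply.
  by rewrite mem_cat orbC (map_f (fun j : 'I_N => inl (inr (val j)))) ?mem_enum.
Qed.

End Independence.

(** * Moments, covariance and coupling of the sampler *)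

Section Sampler.
Context (R : realType) (d : nat) (V S : 'M[R]_d).
Context (d0 : measure_display) (T : measurableType d0) (P : probability T R).
Variables (i : nat -> T -> 'I_d) (g : nat -> T -> R) (Z0 : T -> 'cV[R]_d).
Hypothesis d_gt0 : (0 < d)%N.
Hypothesis S_sym : S^T = S.
Hypothesis SS : S *m S = V.
Hypothesis V_diag : forall k, V k k = 1.
Hypothesis i_measurable : forall n (A : set 'I_d), measurable (i n @^-1` A).
Hypothesis g_measurable : forall n, measurable_fun setT (g n).
Hypothesis Z0_measurable : forall k, measurable_fun setT (fun w => Z0 w k 0).
Hypothesis i_uniform : forall n k, P (i n @^-1` [set k]) = ((d%:R)^-1)%:E.
Hypothesis g_gauss : forall n A, measurable A -> P (g n @^-1` A) = normal_prob 0 1 A.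
Hypothesis Z0_gauss : forall k A, measurable A ->
  P ((fun w => Z0 w k 0) @^-1` A) = normal_prob 0 1 A.
Hypothesis indep : mutually_independent P (source_events i g Z0).

Local Notation X := (Xproc V i g).
Local Notation We := (word_event i).
Local Notation wt n := (d%:R ^- n : R).

Let mWe s : measurable (We s).
Proof. exact: measurable_word_event. Qed.

Let stdZG N s : std_on P (We s) (fun w => col_mx (Z0 w) (noise g N w)).
Proof. exact: std_on_word_event. Qed.

Let stdU n s : size s = n ->
  std_on P (We s) (fun w => Mword S s *m Z0 w + Rword S n s *m noise g n w).
Proof.
move=> sn; have sn' : (size s <= n)%N by rewrite sn.
have [D [_ sD]] := std_on_word S_sym SS V_diag sn' (stdZG n s).
by have := std_on_usubmx sD; under eq_fun do rewrite col_mxKu.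
Qed.

Let stdZ s : std_on P (We s) Z0.
Proof. by have := std_on_usubmx (stdZG 0 s); under eq_fun do rewrite col_mxKu. Qed.

Let PWe n s : size s = n -> fine (P (We s)) = wt n.
Proof.
move=> sn; have -> : P (We s) = (wt (size s))%:E.
  exact: (@prob_word_event _ _ _ _ P i g Z0).
by rewrite sn.
Qed.

Let word_at_We n s w : size s = n -> We s w -> word_at i n w = s.
Proof. by move=> <-. Qed.

Let We_nil : We [::] = setT.
Proof. by apply/seteqP; split. Qed.

(** The events of the words of length [n] partition [T], so [h] is the sum of its restrictions to
    them. *)
Lemma mean_on_words n (h : T -> R) r :
  (forall s, size s = n -> mean_on P (We s) h (r s)) ->
  mean_on P setT h (\sum_(s <- words d n) r s).
Proof.
move=> hr.
apply: (@eq_mean_on _ _ _ _ _ (fun w => \sum_(s <- words d n) \1_(We s) w * h w)) => //.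
  move=> w _; rewrite (bigD1_seq (word_at i n w))/= ?uniq_words ?mem_words ?size_word_at//.
  rewrite indicE mem_set ?mul1r; last by rewrite /word_event/= size_word_at.
  rewrite big_seq_cond big1 ?addr0// => s /andP[/size_words sn sw].
  rewrite indicE memNset ?mul0r// /word_event/= sn => /eqP.
  by rewrite eq_sym (negbTE sw).
apply: mean_on_sum => // s /size_words sn.
by apply: mean_on_setT => //; exact: hr.
Qed.

(** Both sides are the mean of the constant [1], over the words and over [T]. *)
Let sum_wt n : \sum_(s <- words d n) wt n = 1.
Proof.
have [_ e1] := @mean_on_words n (cst 1) (fun s => 1 * fine (P (We s)))
  (fun s _ => mean_on_cst P 1 (mWe s)).
have [_ e2] := mean_on_cst P 1 (measurableT : measurable [set: T]).
have := etrans (esym e2) e1; rewrite probability_setT mulr1 => -[e]; rewrite [RHS]e.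
by apply: eq_big_seq => s /size_words sn; rewrite (PWe sn) mul1r.
Qed.

Lemma mean_mnorm n :
  mean_on P setT (fun w => mnorm V (Mprod S i n w) ^+ 2) (Mtrace V S n).
Proof.
rewrite /Mtrace -sum_words//; apply: mean_on_words => s sn.
apply: (@eq_mean_on _ _ _ _ _ (cst (mnorm V (Mword S s) ^+ 2))) => //.
  by move=> w sw; rewrite Mprod_word (word_at_We sn sw).
have := mean_on_cst P (mnorm V (Mword S s) ^+ 2) (mWe s).
by rewrite (PWe sn) (mnormE S_sym SS) mulrC.
Qed.

Let X_word n s w : size s = n -> We s w ->
  X n w = row_mx 0 (S *m Rword S n s) *m col_mx (Z0 w) (noise g n w).
Proof.
move=> sn sw; rewrite (Xproc_word S_sym SS i g w (leqnn n)) (word_at_We sn sw).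
by rewrite mul_row_col mul0mx add0r mulmxA.
Qed.

Lemma mean_X n k : mean_on P setT (fun w => X n w k 0) 0.
Proof.
have sum0 : \sum_(s <- words d n) 0 = 0 :> R by rewrite big1.
rewrite -[X in mean_on _ _ _ X]sum0.
apply: mean_on_words => s sn.
apply: (eq_mean_on (mWe s)) (mean_on_std_mulmx (row_mx 0 (S *m Rword S n s)) k (stdZG n s)).
by move=> w sw; rewrite (X_word sn sw).
Qed.

Lemma mean_XX n k l : mean_on P setT (fun w => X n w k 0 * X n w l 0)
  (\sum_(s <- words d n) wt n *
     (S *m Rword S n s *m (S *m Rword S n s)^T) k l).
Proof.
apply: mean_on_words => s sn.
rewrite -(PWe sn).
pose A : 'M[R]_(d, d + n) := row_mx 0 (S *m Rword S n s).
have := mean_on_std_mulmx2 A A k l (stdZG n s).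
rewrite /A tr_row_mx mul_row_col mul0mx add0r; apply: eq_mean_on => // w sw.
by rewrite (X_word sn sw).
Qed.

(** Given the word, the second moments of [X n] are [S R R^T S]; inserting [M M^T + R R^T = I]
    between the factors of [V = S S] leaves [S M M^T S]. *)
Lemma cov_X n : V - covmx P (X n) =
  \sum_(s <- words d n) wt n *: (S *m Mword S s *m (S *m Mword S s)^T).
Proof.
have -> : covmx P (X n) = \sum_(s <- words d n) wt n *:
    (S *m Rword S n s *m (S *m Rword S n s)^T).
  apply/matrixP => k l; rewrite mxE /Ex (mean_XX n k l).2 /= summxE.
  by apply: eq_bigr => s _; rewrite [RHS]mxE.
have VE : V = \sum_(s <- words d n) wt n *: V by rewrite -scaler_suml sum_wt scale1r.
rewrite [X in X - _]VE -sumrB.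
apply: eq_big_seq => s /size_words sn; rewrite -scalerBr; congr (_ *: _).
have sn' : (size s <= n)%N by rewrite sn.
have MR := Mword_Rword S_sym SS V_diag sn'.
rewrite -[X in X - _]SS -[X in X *m S - _]mulmx1 -MR mulmxDr mulmxDl.
by rewrite !trmx_mul S_sym !mulmxA addrK.
Qed.

Let trace_words n : \sum_(s <- words d n) wt n *
   \tr (S *m Mword S s *m (S *m Mword S s)^T) = Mtrace V S n.
Proof.
rewrite /Mtrace -sum_words//; apply: eq_bigr => s _.
by rewrite (trace_Mword S_sym SS).
Qed.

Lemma trace_cov_X n : \tr (V - covmx P (X n)) = Mtrace V S n.
Proof.
rewrite cov_X -trace_words raddf_sum/=; apply: eq_bigr => s _.
by rewrite mxtraceZ.
Qed.

Lemma loewner_cov_X n : loewner_le (covmx P (X n)) V.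
Proof.
rewrite /loewner_le cov_X; split.
  rewrite /symmetric_mx raddf_sum/=; apply: eq_bigr => s _.
  by rewrite linearZ/= trmx_mul trmxK.
move=> x; rewrite mulmx_sumr mulmx_suml summxE sumr_ge0// => s _.
rewrite -scalemxAr -scalemxAl mxE mulr_ge0//; set A := S *m Mword S s.
have -> : x^T *m (A *m A^T) *m x = x^T *m A *m (x^T *m A)^T.
  by rewrite (trmx_mul x^T) trmxK !mulmxA.
by rewrite mxE sumr_ge0// => k _; rewrite [X in _ * X]mxE -expr2 sqr_ge0.
Qed.

(* The chain run with the same indices and noise from the stationary state. *)
Let Y n w : 'cV[R]_d := X n w + S *m (Mword S (word_at i n w) *m Z0 w).

Let Y_word n s w : size s = n -> We s w ->
  Y n w = S *m (Mword S s *m Z0 w + Rword S n s *m noise g n w).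
Proof.
move=> sn sw; rewrite /Y (Xproc_word S_sym SS i g w (leqnn n)).
by rewrite (word_at_We sn sw) mulmxDr addrC.
Qed.

(** Here and for [Y], measurability is read off integrability, which is obtained word by word. *)
Let measurable_X n k : measurable_fun [set: T] (fun w => X n w k 0).
Proof. by apply/measurable_EFinP; have [/measurable_int] := mean_X n k. Qed.

Let measurable_Y n k : measurable_fun [set: T] (fun w => Y n w k 0).
Proof.
have : mean_on P setT (fun w => Y n w k 0) (\sum_(s <- words d n) 0).
  apply: mean_on_words => s sn.
  apply: (eq_mean_on (mWe s)) (mean_on_std_mulmx S k (stdU sn)).
  by move=> w sw; rewrite (Y_word sn sw).
by move=> [/measurable_int ? _]; exact/measurable_EFinP.
Qed.

Let mean_on_indic B E : measurable B -> measurable E ->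
  mean_on P B (\1_E) (fine (P (B `&` E))).
Proof.
move=> mB mE; split.
  apply: le_integrable (finite_measure_integrable_cst P 1 mB) => //.
    by apply/measurable_EFinP; exact: measurable_indic.
  by move=> w _ /=; rewrite lee_fin indicE normr1 ger0_norm// lern1 leq_b1.
by rewrite integral_indic// setIC fineK// fin_num_measure//; exact: measurableI.
Qed.

Let measurable_tup_mulmx :
  measurable_fun [set: d.-tuple R] (fun t => tup (S *m \col_k tnth t k)).
Proof.
apply/measurable_fun_tnthP => k.
rewrite (_ : _ \o _ = fun t : d.-tuple R => \sum_l S k l * tnth t l).
  apply: measurable_sum => l; apply: measurable_funM => //.
  exact: measurable_tnth.
by apply/funext => t; rewrite /= tnth_mktuple mxE; apply: eq_bigr => l _; rewrite mxE.
Qed.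

(** On each word event [Y] is [S] applied to a vector that is standard Gaussian there, so its
    conditional law is that of [S Z0] whatever the word. Summing the means of the indicator over the
    words removes the conditioning. *)
Lemma law_Y n (A : set (d.-tuple R)) : measurable A ->
  P ((fun w => tup (Y n w)) @^-1` A) = P ((fun w => tup (S *m Z0 w)) @^-1` A).
Proof.
move=> mA.
have mpre (W : T -> 'cV[R]_d) : (forall k, measurable_fun [set: T] (fun w => W w k 0)) ->
    measurable ((fun w => tup (W w)) @^-1` A).
  by move=> mW; rewrite -[X in measurable X]setTI; exact: measurable_tup.
have mSZ k : measurable_fun [set: T] (fun w => (S *m Z0 w) k 0).
  under eq_fun do rewrite mxE.
  by apply: measurable_sum => l; apply: measurable_funM.
set EY := (fun w => tup (Y n w)) @^-1` A.
set EZ := (fun w => tup (S *m Z0 w)) @^-1` A.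
have mEY : measurable EY by apply: mpre; exact: measurable_Y.
have mEZ : measurable EZ by exact: mpre.
pose A' := (fun t : d.-tuple R => tup (S *m \col_k tnth t k)) @^-1` A.
have mA' : measurable A'.
  by rewrite -[X in measurable X]setTI; exact: measurable_tup_mulmx.
have preA' (W : T -> 'cV[R]_d) :
    (fun w => tup (S *m W w)) @^-1` A = (fun w => tup (W w)) @^-1` A'.
  rewrite /A' -comp_preimage; congr (_ @^-1` A); apply/funext => w /=.
  congr tup; congr (_ *m _); apply/colP => k.
  by rewrite mxE tnth_mktuple.
have stdZT : std_on P setT Z0 by rewrite -We_nil; exact: stdZ.
have : mean_on P setT (\1_EY) (\sum_(s <- words d n) wt n * fine (P EZ)).
  apply: mean_on_words => s sn.
  suff <- : fine (P (We s `&` EY)) = wt n * fine (P EZ) by exact: mean_on_indic.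
  have -> : We s `&` EY = We s `&`
      (fun w => tup (Mword S s *m Z0 w + Rword S n s *m noise g n w)) @^-1` A'.
    rewrite -preA'; apply/seteqP; split => w [sw h]; split=> //.
      by move: h; rewrite /EY /= (Y_word sn sw).
    by move: h; rewrite /EY /= (Y_word sn sw).
  rewrite (std_on_law (stdU sn) stdZT mA') -preA' fineM ?fin_num_measure//.
  by rewrite (PWe sn).
rewrite -mulr_suml sum_wt mul1r => -[_].
by rewrite integral_indic// setIT fineK// fin_num_measure.
Qed.

(** The noise cancels in the difference, [Y - X = S M Z0], whose mean squared norm given the word is
    the trace of [(S M) (S M)^T]. *)
Lemma mean_sqdist n :
  mean_on P setT (fun w => sqdist (tup (X n w), tup (Y n w))) (Mtrace V S n).
Proof.
rewrite -trace_words; apply: mean_on_words => s sn; rewrite -(PWe sn).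
rewrite /mxtrace mulr_sumr.
apply: (@eq_mean_on _ _ _ _ _
  (fun w => \sum_(k < d) (S *m Mword S s *m Z0 w) k 0 * (S *m Mword S s *m Z0 w) k 0)) => //.
  move=> w sw; rewrite /sqdist; apply: eq_bigr => k _ /=.
  rewrite !tnth_mktuple /Y (word_at_We sn sw) -mulmxA.
  by rewrite [in RHS]mxE opprD addNKr sqrrN expr2.
by apply: mean_on_sum => // k _; exact: (mean_on_std_mulmx2 _ _ k k (stdZ s)).
Qed.

(** By [law_Y], the joint law of [X n] and [Y n] is an admissible coupling, and [mean_sqdist] is its
    cost. *)
Lemma W2sq_X n : (0 <= W2sq P (X n) (fun w => S *m Z0 w) <= (Mtrace V S n)%:E)%E.
Proof.
apply/andP; split.
  apply/ereal_infP => _ [mu _ <-]; apply: integral_ge0 => z _.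
  by rewrite lee_fin sumr_ge0// => k _; rewrite sqr_ge0.
have mXY : measurable_fun [set: T] (fun w => (tup (X n w), tup (Y n w))).
  exact: (measurable_fun_pair (measurable_tup (measurable_X n)) (measurable_tup (measurable_Y n))).
apply: ereal_inf_lbound; exists (distribution P (mfun_of mXY)).
  by move=> A mA; split=> //; rewrite -(law_Y n mA).
rewrite -(mean_sqdist n).2 ge0_integral_distribution//.
  apply/measurable_EFinP; apply: measurable_sum => k.
  apply: measurable_funX; apply: measurable_funB.
    exact: (measurableT_comp (measurable_tnth k) measurable_fst).
  exact: (measurableT_comp (measurable_tnth k) measurable_snd).
by move=> z; rewrite lee_fin sumr_ge0// => k _; rewrite sqr_ge0.
Qed.

Lemma W2_X n : (0 < n)%N ->
  (W2 P (X n) (fun w => S *m Z0 w) <= (d%:R / Num.sqrt n%:R)%:E)%E.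
Proof.
move=> n0; rewrite /W2; have := W2sq_X n.
case: (W2sq _ _ _) => [r||]/=; last 2 first.
- by rewrite leye_eq andbF.
- by [].
rewrite !lee_fin => /andP[r0 rM]; rewrite -[d%:R]ger0_norm// -sqrtr_sqr.
rewrite -sqrtrV// -sqrtrM ?sqr_ge0// ler_wsqrtr//.
exact: le_trans rM (Mtrace_le S_sym SS V_diag d_gt0 n0).
Qed.

End Sampler.

Theorem theorem3p1 (R : realType) (d : nat) (V sqrtV : 'M[R]_d)
  (d0 : measure_display) (T : measurableType d0) (P : probability T R)
  (i : nat -> T -> 'I_d) (g : nat -> T -> R) (Z0 : T -> 'cV[R]_d) :
  (0 < d)%N ->
  psd_mx V -> (forall k, V k k = 1) ->
  (* sqrtV = sqrt V : the symmetric positive semi-definite square root of V *)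
  psd_mx sqrtV -> sqrtV *m sqrtV = V ->
  (* measurability *)
  (forall n (A : set 'I_d), measurable (i n @^-1` A)) ->
  (forall n, measurable_fun setT (g n)) ->
  (forall k, measurable_fun setT (fun w => Z0 w k 0)) ->
  (* i_n uniform on {1..d}; g_n and the coordinates of Z_0 standard Gaussian *)
  (forall n k, P (i n @^-1` [set k]) = ((d%:R)^-1)%:E) ->
  (forall n A, measurable A -> P (g n @^-1` A) = normal_prob 0 1 A) ->
  (forall k A, measurable A -> P ((fun w => Z0 w k 0) @^-1` A) = normal_prob 0 1 A) ->
  (* mutual independence of all (i_n), (g_n) and the coordinates of Z_0 *)
  mutually_independent P
    (fun j : (nat + nat + 'I_d)%type =>
       match j with
       | inl (inl n) => [set B | exists A : set 'I_d, B = i n @^-1` A]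
       | inl (inr n) => [set B | exists2 A : set R, measurable A & B = g n @^-1` A]
       | inr k => [set B | exists2 A : set R, measurable A &
                            B = (fun w => Z0 w k 0) @^-1` A]
       end) ->
  let X := Xproc V i g in
  let M := Mprod sqrtV i in
  (* W_2(law X_n, N(0,V)) <= d / sqrt n, with N(0,V) = law of sqrt V Z_0 *)
  (forall n, (0 < n)%N ->
     W2 P (X n) (fun w => sqrtV *m Z0 w) <= (d%:R / Num.sqrt n%:R)%:E)%E /\
  (forall n, (\sum_(0 <= j < n.+1) Ex P (fun w => (mnorm V (M j w) ^+ 2)%R)
              <= (d%:R ^+ 2)%:E)%E) /\
  (forall j, (Ex P (fun w => (mnorm V (M j.+1 w) ^+ 2)%R)
              <= Ex P (fun w => (mnorm V (M j w) ^+ 2)%R))%E) /\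
  (forall n, (0 < n)%N ->
     (forall k, P.-integrable setT (fun w => (X n w k 0)%:E) /\
                Ex P (fun w => X n w k 0) = 0%E) /\
     (forall k l, P.-integrable setT (fun w => (X n w k 0 * X n w l 0)%:E)) /\
     loewner_le (covmx P (X n)) V /\
     \tr (V - covmx P (X n)) <= d%:R ^+ 2 / n%:R).
Proof.
move=> d_gt0 _ V_diag [S_sym _] SS mi mg mZ i_unif g_gauss Z_gauss indep X M.
have Ex_M n : Ex P (fun w => mnorm V (M n w) ^+ 2) = (Mtrace V sqrtV n)%:E.
  exact: (mean_mnorm d_gt0 S_sym SS mi i_unif indep n).2.
split=> [n n_gt0|].
  exact: (W2_X d_gt0 S_sym SS V_diag mi mg mZ i_unif g_gauss Z_gauss indep).
split=> [n|].
  under eq_bigr do rewrite Ex_M.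
  by rewrite sumEFin lee_fin big_mkord; exact: (sum_Mtrace S_sym SS V_diag).
split=> [j|n n_gt0].
  by rewrite !Ex_M lee_fin; exact: (Mtrace_noninc S_sym SS V_diag).
split=> [k|].
  exact: (mean_X S_sym SS mi mg mZ i_unif g_gauss Z_gauss indep n k).
split=> [k l|].
  exact: (mean_XX S_sym SS mi mg mZ i_unif g_gauss Z_gauss indep n k l).1.
split.
  exact: (loewner_cov_X S_sym SS V_diag mi mg mZ i_unif g_gauss Z_gauss indep).
rewrite (trace_cov_X d_gt0 S_sym SS V_diag mi mg mZ i_unif g_gauss Z_gauss indep).
exact: (Mtrace_le S_sym SS V_diag).
Qed.
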